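(* Let $G$ be a planar graph with maximum degree $\Delta\geq 27$ and let $H$ be a subgraph of $G$ that is a distance-3 matching. Then any total-$(\Delta+1)$-coloring of $H$ can be extended to a total-$(\Delta+1)$-coloring of $G$.
   Context: All graphs are simple. A total-$k$-coloring of a graph is an assignment of colors from $\{1,\dots,k\}$ to its vertices and edges such that adjacent vertices receive different colors, edges sharing an endpoint receive different colors, and no edge receives the same color as either of its endpoints. A subgraph $H$ of $G$ is a matching if it consists of vertex-disjoint copies of $K_2$; it is a distance-3 matching if moreover any two vertices in distinct components of $H$ are at distance at least $3$ in $G$. Extending a total coloring $\varphi$ of $H$ to $G$ means finding a total-$k$-coloring of $G$ agreeing with $\varphi$ on all vertices and edges of $H$. *)

(* Defs.v *)
From HB Require Import structures.
From mathcomp Require Import all_boot all_order all_algebra.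
From mathcomp Require Import boolp classical_sets reals topology.
From mathcomp Require Import Rstruct Rstruct_topology.
From Stdlib Require Import Reals.
Set Implicit Arguments. Unset Strict Implicit. Unset Printing Implicit Defensive.
Import Order.TTheory GRing.Theory Num.Theory.

Definition simple_graph (V : finType) (e : rel V) : Prop :=
  symmetric e /\ irreflexive e.

Definition max_degree (V : finType) (e : rel V) : nat :=
  (\max_(v : V) #|[set w | e v w]|)%N.

Local Open Scope classical_set_scope.
Local Open Scope ring_scope.
Definition unit_itv : set R := [set t : R | 0 <= t <= 1].
Definition open_unit_itv : set R := [set t : R | 0 < t < 1].

Definition planar (V : finType) (e : rel V) : Prop :=
  exists (p : V -> (R * R)%type) (c : V -> V -> R -> (R * R)%type),
    injective p /\
    (forall x y, e x y ->
       {within unit_itv, continuous (c x y)} /\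
       {in unit_itv &, injective (c x y)} /\
       c x y 0 = p x /\ c x y 1 = p y /\
       (forall t z, open_unit_itv t -> c x y t <> p z)) /\
    (forall x y x' y', e x y -> e x' y' ->
       ~ ((x == x') && (y == y') || (x == y') && (y == x')) ->
       forall s t, open_unit_itv s -> open_unit_itv t -> c x y s <> c x' y' t).
Local Close Scope ring_scope.
Local Close Scope classical_set_scope.

Definition total_coloring (V : finType) (A : pred V) (r : rel V) (k : nat)
    (cv : V -> nat) (ce : V -> V -> nat) : Prop :=
  (forall x, A x -> (1 <= cv x <= k)%N) /\
  (forall x y, r x y ->
     [/\ (1 <= ce x y <= k)%N, ce x y = ce y x, cv x != cv y,
         ce x y != cv x & ce x y != cv y]) /\
  (forall x y z, r x y -> r x z -> y != z -> ce x y != ce x z).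

(* M (a symmetric subrelation of e) is the edge relation of a subgraph H of G
   which is a matching; H's vertices are the endpoints of M-edges. *)
Definition matching_vertices (V : finType) (M : rel V) : pred V :=
  [pred x | [exists y, M x y]].

(* H is a distance-3 matching of G: H is a matching (vertex-disjoint K2's),
   and vertices in distinct components are at distance >= 3 in G. *)
Definition distance3_matching (V : finType) (e M : rel V) : Prop :=
  symmetric M /\ subrel M e /\
  (forall x y z, M x y -> M x z -> y = z) /\
  (forall x y u w, M x y -> M u w -> x != u -> x != w ->
     [/\ ~~ e x u, ~~ e x w,
         (forall z, ~~ (e x z && e z u)) & (forall z, ~~ (e x z && e z w))]).

(* Main.v *)
(** A planar graph has no K5 minor, so (Mader) every nonempty vertex set S spans
    fewer than 3|S| edges.  In an inextendable configuration with k >= 28 colors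
    that is minimal in the number of edges, Galvin's list coloring theorem yields,
    for 2 <= j <= 5, that the set Y_j of uncolored vertices of degree at most j has
    at most (j - 1)|W| elements, where W is the set of vertices of degree at
    least 24; and the neighbors of a vertex of Y_5 all lie in W.  Moreover each
    vertex is adjacent to at most two precolored ones.  Hence, once the precolored
    vertices of degree at most 6 are dropped, the total deficit below degree 6 is
    at most 10|W|, which the vertices of W make up for: the average degree is at
    least 6, a contradiction.

    For the absence of K5 minors: if two paths g, h avoid each other,
    then g(s) - h(t) never vanishes on a square, so the winding of this vector
    along the boundary of the square is 0.  Modulo 2 this relates the windings of
    the edges of a drawn K5 around its vertices; summing over the 15 pairs of
    independent edges, the windings cancel and a parity contradiction remains. *)

Require Import Defs.
From mathcomp Require Import all_boot.
From mathcomp Require Import boolp zify.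
Set Implicit Arguments. Unset Strict Implicit. Unset Printing Implicit Defensive.

(** * Contractions and K5 minors *)

Section Minors.
Variable V : finType.
Implicit Types (e : rel V) (A B S : {set V}).

Definition restrict e B : rel V := [rel x y | [&& x \in B, y \in B & e x y]].

(** Being pairwise adjacent, the branch sets [B i] are nonempty. *)
Definition K5_minor e : Prop := exists B : nat -> {set V},
  (forall i, i < 5 -> {in B i &, forall x y, connect (restrict e (B i)) x y}) /\
  (forall i j, i < j < 5 -> [disjoint B i & B j] /\
     exists x y, [/\ x \in B i, y \in B j & e x y]).

Definition edge_pairs e : {set V * V} := [set p | e p.1 p.2].

Definition nbrs e (x : V) : {set V} := [set y | e x y].

Lemma card_edge_pairs e : #|edge_pairs e| = \sum_x #|nbrs e x|.
Proof.
rewrite -sum1_card.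
have -> : \sum_x #|nbrs e x| = \sum_x \sum_(y in nbrs e x) 1.
  by apply: eq_bigr => x _; rewrite sum1_card.
rewrite (pair_big_dep predT (fun x y => y \in nbrs e x) (fun _ _ => 1)) /=.
by apply: eq_bigl => -[x y]; rewrite !inE.
Qed.

Lemma uniq_seq_of_size (A : {set V}) n : n <= #|A| -> exists s, [/\ size s = n, uniq s & {subset s <= A}].
Proof.
rewrite cardE => h; exists (take n (enum A)); split; first by rewrite size_takel.
  exact: take_uniq (enum_uniq _).
by move=> x /mem_take; rewrite mem_enum.
Qed.

Lemma K5_minorW e e' : subrel e' e -> K5_minor e' -> K5_minor e.
Proof.
move=> sub [B [cB aB]]; exists B; split=> [i i5 x y xB yB | i j ij].
  apply: connect_sub (cB i i5 x y xB yB) => a b /and3P[aBi bBi ab].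
  by apply: connect1; rewrite /restrict /= aBi bBi sub.
by have [dB [x [y [xB yB xy]]]] := aB i j ij; split=> //; exists x, y; split=> //; apply: sub.
Qed.

(** The vertex [y] is merged into [x] and survives as an isolated vertex. *)
Definition contract e (x y : V) : rel V := [rel a b |
  [&& a != y, b != y, a != b & [|| e a b, (a == x) && e y b | (b == x) && e y a]]].

Lemma K5_minor_contract e x y : symmetric e -> e x y -> K5_minor (contract e x y) -> K5_minor e.
Proof.
move=> se xy [B [cB aB]].
have yB i : i < 5 -> y \notin B i.
  move=> i5; apply/negP => yBi.
  have [z zBi zny] : exists2 z, z \in B i & z != y.
    have [j [i_j | j_i]] : exists j, i < j < 5 \/ j < i < 5.
      by case: (posnP i) => i0; [exists 1 | exists 0]; lia.
      have [_ [a [b [aB1 _ /and3P[any _ _]]]]] := aB _ _ i_j; by exists a.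
    by have [_ [a [b [_ bB1 /and3P[_ bny _]]]]] := aB _ _ j_i; exists b.
  have /connectP[[|p ps] /=] := cB i i5 y z yBi zBi; first by move=> _ /eqP; rewrite (negPf zny).
  by rewrite /restrict /contract /= eqxx !andbF.
pose B' i := if x \in B i then y |: B i else B i.
have BB' i a : a \in B i -> a \in B' i by rewrite /B'; case: ifP => // _; rewrite !inE orbC => ->.
have yB' i : x \in B i -> y \in B' i by rewrite /B' => ->; rewrite !inE eqxx.
exists B'; split=> [i i5 | i j ij].
  have step a b : restrict (contract e x y) (B i) a b -> connect (restrict e (B' i)) a b.
    move=> /and3P[aB1 bB1 /and4P[any bny anb]].
    case/or3P=> [ab | /andP[/eqP ax yb] | /andP[/eqP bx ya]].
    - by apply: connect1; apply/and3P; split; first [exact: BB' | exact: yB' | by [] | by rewrite se].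
    - subst a; apply: (@connect_trans _ _ y); apply: connect1.
        by apply/and3P; split; first [exact: BB' | exact: yB' | by [] | by rewrite se].
      by apply/and3P; split; first [exact: BB' | exact: yB' | by [] | by rewrite se].
    - subst b; apply: (@connect_trans _ _ y); apply: connect1.
        by apply/and3P; split; first [exact: BB' | exact: yB' | by [] | by rewrite se].
      by apply/and3P; split; first [exact: BB' | exact: yB' | by [] | by rewrite se].
  have inB a b : a \in B i -> b \in B i -> connect (restrict e (B' i)) a b.
    by move=> aB1 bB1; apply: connect_sub (cB i i5 a b aB1 bB1).
  have memB' a : a \in B' i -> a = y /\ x \in B i \/ a \in B i.
    by rewrite /B'; case: ifP => xB; [case/setU1P; auto | right].
  have toy a : x \in B i -> a \in B i -> connect (restrict e (B' i)) a y.
    move=> xB aB1; apply: connect_trans (inB _ _ aB1 xB) _.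
    by apply: connect1; apply/and3P; split; first [exact: BB' | exact: yB' | by [] | by rewrite se].
  have ofy a : x \in B i -> a \in B i -> connect (restrict e (B' i)) y a.
    move=> xB aB1; apply: connect_trans (inB _ _ xB aB1).
    by apply: connect1; apply/and3P; split; first [exact: BB' | exact: yB' | by [] | by rewrite se].
  move=> a b /memB'[[-> xB]| aB1] /memB'[[-> xB1]| bB1];
  by [apply: connect0 | apply: ofy | apply: toy | apply: inB].
have [dB [a [b [aB1 bB1 /and4P[any bny anb ab]]]]] := aB i j ij; split.
  case/andP: ij => ij j5; have yi := yB i (ltn_trans ij j5); have yj := yB j j5.
  apply/pred0P => c /=; apply/negbTE; apply/negP => /andP[].
  rewrite /B'; case: ifP => xBi; case: ifP => xBj; rewrite ?inE.
  - by rewrite (disjointFr dB xBi) in xBj.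
  - by case/orP=> [/eqP-> | cBi]; [rewrite (negPf yj) | rewrite (disjointFr dB cBi)].
  - by move=> cBi /orP[/eqP cy | ]; [rewrite cy (negPf yi) in cBi | rewrite (disjointFr dB cBi)].
  - by move=> cBi; rewrite (disjointFr dB cBi).
case/or3P: ab => [ab | /andP[/eqP ax yb] | /andP[/eqP bx ya]].
- by exists a, b; split=> //; apply: BB'.
- by exists y, b; split=> //; [apply: yB'; rewrite -ax | apply: BB'].
- by exists a, y; split=> //; [apply: BB' | apply: yB'; rewrite -bx | rewrite se].
Qed.

Lemma card_edge_pairs_contract e x y : symmetric e -> irreflexive e -> e x y ->
  #|edge_pairs e| <= #|edge_pairs (contract e x y)| + 2 + #|nbrs e x :&: nbrs e y|.*2.
Proof.
move=> se ie xy.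
pose E0 := [set p in edge_pairs e | (p.1 != y) && (p.2 != y)].
pose X := nbrs e y :\: nbrs e x :\ x.
have xny : x != y by apply: contraTneq xy => ->; rewrite ie.
have cN : #|nbrs e y| = #|X| + 1 + #|nbrs e x :&: nbrs e y|.
  rewrite -(cardsID (nbrs e x) (nbrs e y)) setIC (cardsD1 x (_ :\: _)) !inE ie se xy /=.
  by rewrite -/X addnC [1 + _]addnC.
have E_le : #|edge_pairs e| <= #|E0| + #|nbrs e y|.*2.
  have -> : edge_pairs e = E0 :|: ((fun b => (y, b)) @: nbrs e y :|: (fun b => (b, y)) @: nbrs e y).
    apply/setP => -[a b]; rewrite !inE /=; apply/idP/idP => [ab|].
      rewrite ab /=; have [ay|any] /= := eqVneq a y.
        by apply/orP; left; apply/imsetP; exists b; rewrite ?ay // inE -ay.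
      have [bY|bny] //= := eqVneq b y.
      by apply/orP; right; apply/imsetP; exists a; rewrite ?bY // inE -bY se.
    case/or3P=> [/andP[] // | /imsetP[c + [-> ->]] | /imsetP[c + [-> ->]]]; rewrite inE //.
    by rewrite se.
  apply: leq_trans (leq_card_setU _ _) _; rewrite leq_add2l -addnn.
  by apply: leq_trans (leq_card_setU _ _) _; apply: leq_add; apply: leq_imset_card.
have E'_ge : #|E0| + #|X|.*2 <= #|edge_pairs (contract e x y)|.
  have dis : [disjoint E0 & (fun b => (x, b)) @: X :|: (fun b => (b, x)) @: X].
    apply/pred0P => -[a b]; rewrite !inE /=; apply/negbTE; apply/negP => /andP[/and3P[ab _ _]].
    by case/orP=> /imsetP[c + [aE bE]]; rewrite !inE -?bE -?aE => /and3P[_ /negP[]]; rewrite ?ab // se.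
  have dis2 : [disjoint (fun b => (x, b)) @: X & (fun b => (b, x)) @: X].
    apply/pred0P => -[a b]; rewrite !inE /=; apply/negbTE; apply/negP => /andP[].
    by move=> /imsetP[c + [aE bE]] => + /imsetP[d + [_ dx]]; rewrite -bE dx !inE eqxx.
  have <- : #|E0 :|: ((fun b => (x, b)) @: X :|: (fun b => (b, x)) @: X)| = #|E0| + #|X|.*2.
    rewrite cardsU disjoint_setI0 // cards0 subn0 cardsU (disjoint_setI0 dis2) cards0 subn0.
    by rewrite !card_imset ?addnn // => ? ? [].
  apply: subset_leq_card; apply/subsetP => -[a b]; rewrite !inE /contract /=.
  case/or3P=> [/and3P[ab -> ->] | /imsetP[c + [-> ->]] | /imsetP[c + [-> ->]]] /=.
  - by rewrite ab /= andbT; apply: contraTneq ab => ->; rewrite ie.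
  - rewrite !inE => /and3P[cx _ yc]; apply/and4P; split; rewrite ?eqxx ?yc ?orbT //.
      by apply: contraTneq yc => ->; rewrite ie.
    by rewrite eq_sym.
  - rewrite !inE => /and3P[cx _ yc]; apply/and4P; split; rewrite ?eqxx ?yc ?orbT //.
    by apply: contraTneq yc => ->; rewrite ie.
lia.
Qed.

Lemma K5_minor_sets e (A B C D E : {set V}) :
  all (fun X : {set V} => [forall x in X, forall y in X, connect (restrict e X) x y]) [:: A; B; C; D; E] ->
  pairwise (fun X Y : {set V} => [disjoint X & Y] && [exists x in X, exists y in Y, e x y])
    [:: A; B; C; D; E] -> K5_minor e.
Proof.
move=> conn pw; exists (fun i => nth set0 [:: A; B; C; D; E] i); split=> [i i5 | i j /andP[ij j5]].
  have /forall_inP h := allP conn _ (mem_nth set0 (i5 : i < size [:: A; B; C; D; E])).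
  by move=> x y /h /forall_inP h2 /h2.
have /andP[dij /exists_inP[x xX /exists_inP[y yY xy]]] :=
  (pairwiseP set0 pw) i j (ltn_trans ij j5) j5 ij.
by split=> //; exists x, y.
Qed.

Lemma dense_nbrs_K5_minor e (v : V) : symmetric e -> irreflexive e ->
  0 < #|nbrs e v| <= 5 ->
  (forall x y, e x y -> 2 < #|nbrs e x :&: nbrs e y|) -> K5_minor e.
Proof.
move=> se ie /andP[deg0 deg5] tri.
have nbr3 x : e v x -> 2 < #|nbrs e v :&: nbrs e x| by apply: tri.
have one_missing a b c : e v a -> e v b -> e v c -> a != b -> a != c -> b != c ->
    ~~ e a b -> e a c.
  move=> va vb vc ab ac bc nab; apply: contraT => nac.
  have sub : nbrs e v :&: nbrs e a \subset nbrs e v :\ a :\ b :\ c.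
    apply/subsetP => z; rewrite !inE => /andP[-> az]; rewrite andbT.
    by apply/and3P; split; apply: contraTneq az => ->; rewrite ?ie.
  have := leq_trans (nbr3 a va) (subset_leq_card sub).
  have := cardsD1 a (nbrs e v); have := cardsD1 b (nbrs e v :\ a).
  have := cardsD1 c (nbrs e v :\ a :\ b).
  rewrite !inE va vb vc (eq_sym b a) (eq_sym c a) (eq_sym c b) ab ac bc /=.
  by move: deg5; lia.
have conn1 x : [forall y in [set x], forall z in [set x], connect (restrict e [set x]) y z].
  by apply/forall_inP => y /set1P->; apply/forall_inP => z /set1P->.
have dis1 (x y : V) : x != y -> [disjoint [set x] & [set y]] by rewrite disjoints1 inE.
have adj (X Y : {set V}) (x y : V) : x \in X -> y \in Y -> e x y -> [exists x in X, exists y in Y, e x y].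
  by move=> xX yY xy; apply/exists_inP; exists x => //; apply/exists_inP; exists y.
have vne x : e v x -> v != x by apply: contraTneq => <-; rewrite ie.
have [a va] : exists a, e v a by case/card_gt0P: deg0 => a; rewrite inE; exists a.
have [/existsP[x /existsP[y /and4P[vx vy xny nxy]]] | clique] :=
  boolP [exists x, exists y, [&& e v x, e v y, x != y & ~~ e x y]].
  have [s [size_s us ss]] := uniq_seq_of_size (nbr3 x vx).
  case: s size_s us ss => [|c [|d [|f []]]] //= _; rewrite !inE negb_or andbT => /andP[/andP[cd cf] df] ss.
  have mem z : z \in [:: c; d; f] -> [/\ e v z, e x z, z != x, z != y & e y z].
    move=> /ss; rewrite !inE => /andP[vz xz].
    have zx : z != x by apply: contraTneq xz => ->; rewrite ie.
    have zy : z != y by apply: contraNneq nxy => <-.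
    by split=> //; apply: (one_missing y x z); rewrite // 1?eq_sym // se.
  have {ss} [] := (mem c, mem d, mem f); rewrite !inE !eqxx ?orbT.
  move=> [/(_ isT)[vc xc cx cy yc] /(_ isT)[vd xd dx dy yd]] /(_ isT)[vf xf fx fy yf].
  have fin p q r : e v p -> e v q -> e v r -> e x p -> e x q -> e x r -> e y p -> e y q -> e y r ->
      p != x -> p != y -> q != x -> q != y -> r != x -> r != y -> p != q -> p != r -> q != r ->
      e q r -> K5_minor e.
    move=> vp vq vr xp xq xr yp yq yr px py qx qy rx ry pq pr qr eqr.
    apply: (@K5_minor_sets e [set v] [set x; p] [set y] [set q] [set r]).
      rewrite /= !conn1 /= andbT.
      apply/forall_inP => z zX; apply/forall_inP => t tX.
      have [-> | znt] := eqVneq z t; first exact: connect0.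
      apply: connect1; apply/and3P; split=> //.
      move: zX tX znt; rewrite !inE => /orP[] /eqP-> /orP[] /eqP->; rewrite ?eqxx // => _.
      by rewrite se.
    have dis2 z : z != x -> z != p -> [disjoint [set x; p] & [set z]].
      by move=> zx zp; rewrite disjoint_sym disjoints1 !inE negb_or zx.
    have [[[[vx1 vy1] vp1] vq1] vr1] := (vne x vx, vne y vy, vne p vp, vne q vq, vne r vr).
    rewrite /= !andbT disjoints1 !inE negb_or.
    rewrite !dis1 ?dis2 ?vx1 ?vp1 //= 1?eq_sym //.
    rewrite (adj _ _ v x) ?inE ?eqxx // (adj _ _ v y) ?inE // (adj _ _ v q) ?inE // (adj _ _ v r) ?inE //=.
    rewrite (adj _ _ p y) ?inE ?eqxx ?orbT // 1?se // (adj _ _ x q) ?inE ?eqxx // (adj _ _ x r) ?inE ?eqxx //=.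
    by rewrite (adj _ _ y q) ?inE // (adj _ _ y r) ?inE // (adj _ _ q r) ?inE.
  have [edf | ndf] := boolP (e d f); first by apply: (fin c d f).
  have edc : e d c by apply: (one_missing d f c); rewrite // 1?eq_sym.
  by apply: (fin f c d); rewrite // 1?eq_sym // se.
have cl x y : e v x -> e v y -> x != y -> e x y.
  move=> vx vy xny; apply: contraNT clique => nxy.
  by apply/existsP; exists x; apply/existsP; exists y; apply/and4P.
have [s [size_s us ss]] := uniq_seq_of_size (nbr3 a va).
case: s size_s us ss => [|c [|d [|f []]]] //= _; rewrite !inE negb_or andbT => /andP[/andP[cd cf] df] ss.
have mem z : z \in [:: c; d; f] -> e v z /\ a != z.
  move=> /ss; rewrite !inE => /andP[vz az]; split=> //.
  by apply: contraTneq az => <-; rewrite ie.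
have {ss} [] := (mem c, mem d, mem f); rewrite !inE !eqxx ?orbT.
move=> [/(_ isT)[vc ac] /(_ isT)[vd ad]] /(_ isT)[vf af].
apply: (@K5_minor_sets e [set v] [set a] [set c] [set d] [set f]).
  by rewrite /= !conn1.
rewrite /= !andbT !dis1 ?vne //=.
rewrite (adj _ _ v a) ?inE // (adj _ _ v c) ?inE // (adj _ _ v d) ?inE // (adj _ _ v f) ?inE //=.
have [[eac ead] eaf] : (e a c /\ e a d) /\ e a f by split; [split|]; apply: cl.
have [[ecd ecf] edf] : (e c d /\ e c f) /\ e d f by split; [split|]; apply: cl.
rewrite (adj _ _ a c) ?inE // (adj _ _ a d) ?inE // (adj _ _ a f) ?inE //=.
by rewrite (adj _ _ c d) ?inE // (adj _ _ c f) ?inE // (adj _ _ d f) ?inE.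
Qed.

Lemma mader_K5 e S : symmetric e -> irreflexive e -> (forall x y, e x y -> x \in S) ->
  2 < #|S| -> 6 * #|S| <= #|edge_pairs e| + 10 -> K5_minor e.
Proof.
pose N := #|{: V * V}|.+1.
move: {2}(_ + _).+1 (ltnSn (#|S| * N + #|edge_pairs e|)) => n.
elim: n => // n IH in e S * => lt_n se ie eS S3 dense.
have eS2 x y : e x y -> y \in S by rewrite se => /eS.
have card_le : #|edge_pairs e| + #|S| <= #|S| * #|S|.
  rewrite -cardsX; have <- : #|[set (x, x) | x in S]| = #|S| by rewrite card_imset // => ? ? [].
  set D := [set _ | _ in S]; have DS : D \subset setX S S.
    by apply/subsetP => -[x y] /imsetP[z zS [-> ->]]; rewrite !inE zS.
  rewrite -(cardsID D (setX S S)) (setIidPr DS) addnC leq_add2l subset_leq_card //.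
  apply/subsetP => -[x y]; rewrite !inE /= => xy; rewrite (eS _ _ xy) (eS2 _ _ xy) !andbT.
  by apply/imsetP => -[z _ [xz yz]]; rewrite xz yz ie in xy.
have S4 : 3 < #|S|.
  rewrite ltn_neqAle S3 andbT; apply/eqP => S3e; move: card_le dense; rewrite -S3e; lia.
have [/existsP[x /existsP[y /andP[xy few]]] | many] :=
  boolP [exists x, exists y, e x y && (#|nbrs e x :&: nbrs e y| <= 2)].
  have cc := card_edge_pairs_contract se ie xy.
  apply: (K5_minor_contract se xy).
  have cS : #|S| = #|S :\ y|.+1 by rewrite (cardsD1 y) (eS2 _ _ xy).
  apply: (IH _ (S :\ y)).
  - rewrite ltnS in lt_n; apply: leq_trans lt_n; rewrite cS mulSn.
    by apply: leq_trans (leq_addr _ _); rewrite -addnS addnC leq_add2r ltnS max_card.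
  - move=> a b; rewrite /contract /= [b == a]eq_sym (se b a) andbCA.
    by do 3 congr (_ && _); congr (_ || _); rewrite orbC.
  - by move=> a; rewrite /contract /= eqxx !andbF.
  - move=> a b /and4P[any bny anb]; rewrite !inE any /= => /or3P[/eS // | /andP[/eqP-> _] | /andP[_ ya]].
      exact: eS xy.
    by apply: (eS2 y).
  - by rewrite cS in S4.
  - rewrite cS in dense; lia.
have [/existsP[v /andP[vS deg]] | high] := boolP [exists v, (v \in S) && (#|nbrs e v| <= 5)].
  have [deg0 | deg0] := posnP #|nbrs e v|.
    apply: (IH e (S :\ v)) => //; have cS : #|S| = #|S :\ v|.+1 by rewrite (cardsD1 v) vS.
    - by rewrite ltnS in lt_n; apply: leq_trans lt_n; rewrite ltn_add2r ltn_mul2r cS /=.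
    - move=> x y xy; rewrite !inE (eS _ _ xy) andbT; apply/eqP => xv.
      by have /card0_eq/(_ y) := deg0; rewrite inE -xv xy.
    - by rewrite cS in S4.
    - by rewrite cS in dense; lia.
  apply: (@dense_nbrs_K5_minor e v) => //; first by rewrite deg0.
  move=> x y xy; rewrite ltnNge; apply: contraNN many => few.
  by apply/existsP; exists x; apply/existsP; exists y; rewrite xy.
have E6 : 6 * #|S| <= #|edge_pairs e|.
  rewrite card_edge_pairs mulnC -sum_nat_const.
  rewrite [leqRHS](bigID (mem S)) /= -[leqLHS]addn0; apply: leq_add => //; apply: leq_sum => v vS.
  rewrite leqNgt; apply: contraNN high => lt; apply/existsP; exists v; rewrite vS /=.
  by rewrite -ltnS.
have [[x y]] : exists p, p \in edge_pairs e by apply/card_gt0P; lia.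
rewrite inE /= => xy.
pose e' : rel V := [rel a b | e a b && ~~ ((a == x) && (b == y) || (a == y) && (b == x))].
have E' : #|edge_pairs e| <= #|edge_pairs e'| + 2.
  have sub : edge_pairs e \subset edge_pairs e' :|: [set (x, y); (y, x)].
    by apply/subsetP => -[a b]; rewrite !inE /e' /= !xpair_eqE => ->; rewrite orNb.
  apply: leq_trans (subset_leq_card sub) _; apply: leq_trans (leq_card_setU _ _) _.
  by rewrite leq_add2l cards2; case: (_ != _).
have E'lt : #|edge_pairs e'| < #|edge_pairs e|.
  apply: proper_card; apply/properP; split; first by apply/subsetP => -[a b]; rewrite !inE /= => /andP[].
  by exists (x, y); rewrite !inE /e' /= ?xy // !eqxx.
apply: (@K5_minorW e e'); first by move=> a b /andP[].
apply: (IH _ S) => //.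
- by rewrite ltnS in lt_n; apply: leq_trans lt_n; rewrite ltn_add2l.
- by move=> a b; rewrite /e' /= se; congr (_ && ~~ _); rewrite orbC (andbC (a == y)) (andbC (a == x)).
- by move=> a; rewrite /e' /= ie.
- by move=> a b /andP[/eS].
- lia.
Qed.
End Minors.

(** * List edge colorings of bipartite graphs *)

Section BipartiteEdgeColoring.
Variables U W : finType.
Implicit Types (E F K : {set U * W}) (e f : U * W).

Definition proper_on (C : eqType) E (col : U * W -> C) : Prop :=
  {in E &, forall e f, e.1 = f.1 \/ e.2 = f.2 -> col e = col f -> e = f}.

Definition edges_at1 E (u : U) : {set U * W} := [set e in E | e.1 == u].
Definition edges_at2 E (w : W) : {set U * W} := [set e in E | e.2 == w].

Section Galvin.
(** At each endpoint, the edge of smaller rank is preferred. *)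
Variables rU rW : U * W -> nat.

Lemma stable_matching E :
  {in E &, forall e f, e.1 = f.1 -> rU e = rU f -> e = f} ->
  {in E &, forall e f, e.2 = f.2 -> rW e = rW f -> e = f} ->
  exists K, [/\ K \subset E, {in K &, forall e f, e.1 = f.1 \/ e.2 = f.2 -> e = f} &
    forall e, e \in E -> e \notin K ->
      exists2 f, f \in K & f.1 = e.1 /\ rU f < rU e \/ f.2 = e.2 /\ rW f < rW e].
Proof.
move: {2}#|E|.+1 (ltnSn #|E|) => n; elim: n => // n IH in E *; rewrite ltnS => le_n injU injW.
pose best := [set e in E | [forall f in E, (f.1 == e.1) ==> (rU e <= rU f)]].
have bestE e : e \in best -> e \in E by rewrite inE => /andP[].
have best_le e f : e \in best -> f \in E -> f.1 = e.1 -> rU e <= rU f.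
  by rewrite inE => /andP[_ /forall_inP h] /h + fe; rewrite fe eqxx.
have [match2 | /forall_inPn[e eb /forall_inPn[f fb]]] :=
    boolP [forall e in best, forall f in best, (e.2 == f.2) ==> (e == f)].
  exists best; split.
  - by apply/subsetP => e /bestE.
  - move=> e f eb fb [e1 | e2].
      apply: injU => //; try exact: bestE.
      by apply/eqP; rewrite eqn_leq !best_le // ?bestE.
    have /forall_inP/(_ _ eb)/forall_inP/(_ _ fb) := match2.
    by rewrite e2 eqxx => /eqP.
  move=> e eE; rewrite inE eE /= => /forall_inPn[f fE]; rewrite negb_imply -ltnNge => /andP[/eqP fe lt_fe].
  have fA : f \in edges_at1 E e.1 by rewrite inE fE fe eqxx.
  case: (@arg_minnP _ f (mem (edges_at1 E e.1)) rU fA) => g /=; rewrite inE => /andP[gE /eqP ge] g_min.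
  exists g.
    rewrite inE gE; apply/forall_inP => h hE; apply/implyP => /eqP hg.
    by apply: g_min; rewrite inE hE hg ge eqxx.
  by left; split=> //; apply: leq_ltn_trans lt_fe; apply: g_min.
rewrite negb_imply => /andP[/eqP ef2 nef].
(* [f] is dominated by [e], which no edge is preferred to at its [U]-end; so a
   stable matching of [E :\ f] also dominates [f]. *)
wlog lt_ef : e f eb fb ef2 nef / rW e < rW f.
  move=> wl; have : rW e != rW f by apply: contra nef => /eqP h; apply/eqP; apply: injW; rewrite ?bestE.
  by rewrite neq_ltn => /orP[] lt; [apply: (wl e f) | apply: (wl f e); rewrite // eq_sym].
have [|||K [KE Km Kd]] := IH (E :\ f).
- by apply: leq_trans le_n; rewrite (cardsD1 f E) bestE.
- by move=> a b /setD1P[_ aE] /setD1P[_ bE]; apply: injU.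
- by move=> a b /setD1P[_ aE] /setD1P[_ bE]; apply: injW.
exists K; split=> //; first by apply: subset_trans KE _; apply: subsetDl.
move=> g gE gK; have [gf | ngf] := eqVneq g f; last by apply: Kd; rewrite // !inE ngf.
subst g; have [eK | eK] := boolP (e \in K); first by exists e => //; right.
have [|h hK [[h1 lt_h] | [h2 lt_h]]] := Kd e _ eK; first by rewrite !inE nef bestE.
  have : rU e <= rU h by apply: best_le => //; have /subsetP/(_ _ hK)/setD1P[] := KE.
  by rewrite leqNgt lt_h.
by exists h => //; right; rewrite h2 ef2; split=> //; apply: ltn_trans lt_ef.
Qed.

Lemma galvin (C : finType) (c0 : C) E (L : U * W -> {set C}) :
  {in E &, forall e f, e.1 = f.1 -> rU e = rU f -> e = f} ->
  {in E &, forall e f, e.2 = f.2 -> rW e = rW f -> e = f} ->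
  (forall e, e \in E -> #|[set f in edges_at1 E e.1 | rU f < rU e]| +
    #|[set f in edges_at2 E e.2 | rW f < rW e]| < #|L e|) ->
  exists2 col, forall e, e \in E -> col e \in L e & proper_on E col.
Proof.
have arith (t : bool) a1 a2 b1 b2 l :
    a1 + a2 + (b1 + b2) < t + l -> (t -> 0 < a1 + b1) -> a2 + b2 < l.
  by clear; case: t => /= h1 h2; [have := h2 isT | ]; lia.
move: {2}#|E|.+1 (ltnSn #|E|) => n; elim: n => // n IH in E L *; rewrite ltnS => le_n injU injW large.
have [-> | [e0 e0E]] := set_0Vmem E.
  by exists (fun=> c0) => [e | e f]; rewrite inE.
have [c cL] : exists c, c \in L e0 by apply/card_gt0P; apply: leq_ltn_trans (large _ e0E).
pose Ec := [set e in E | c \in L e].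
have EcE : Ec \subset E by apply/subsetP => e; rewrite inE => /andP[].
have [|| K [KEc Km Kd]] := @stable_matching Ec.
- by move=> e f /(subsetP EcE) eE /(subsetP EcE) fE; apply: injU.
- by move=> e f /(subsetP EcE) eE /(subsetP EcE) fE; apply: injW.
have KE : K \subset E by apply: subset_trans KEc EcE.
have [k0 k0K] : exists k, k \in K.
  have [|/Kd[] ] := boolP (e0 \in K); first by exists e0.
    by rewrite inE e0E.
  by move=> f; exists f.
have [|e f|e f|e /setDP[eE eK]|col colL colP] := IH (E :\: K) (fun e => L e :\ c).
- apply: leq_trans le_n; apply: proper_card; apply/properP; split; first exact: subsetDl.
  by exists k0; rewrite ?(subsetP KE) // inE k0K.
- by move=> /setDP[eE _] /setDP[fE _]; apply: injU.
- by move=> /setDP[eE _] /setDP[fE _]; apply: injW.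
- have sub1 : [set f in edges_at1 (E :\: K) e.1 | rU f < rU e] \subset
      [set f in edges_at1 E e.1 | rU f < rU e] :\: K.
    by apply/subsetP => f; rewrite !inE => /andP[/andP[/andP[-> ->] ->] ->].
  have sub2 : [set f in edges_at2 (E :\: K) e.2 | rW f < rW e] \subset
      [set f in edges_at2 E e.2 | rW f < rW e] :\: K.
    by apply/subsetP => f; rewrite !inE => /andP[/andP[/andP[-> ->] ->] ->].
  apply: leq_ltn_trans (leq_add (subset_leq_card sub1) (subset_leq_card sub2)) _.
  have := large e eE; rewrite (cardsD1 c (L e)).
  rewrite -(cardsID K [set f in edges_at1 E e.1 | rU f < rU e]).
  rewrite -(cardsID K [set f in edges_at2 E e.2 | rW f < rW e]).
  move/arith; apply=> cLe; have [|f fK dom] := Kd e _ eK; first by rewrite inE eE.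
  have fE := subsetP KE f fK.
  rewrite addn_gt0; apply/orP.
  case: dom => -[fe lt_fe]; [left | right]; apply/card_gt0P; exists f;
    by rewrite !inE fE fe eqxx lt_fe fK.
exists (fun e => if e \in K then c else col e).
  move=> e eE; case: ifP => eK; first by have := subsetP KEc e eK; rewrite inE => /andP[].
  by have := colL e; rewrite !inE eK eE => /(_ isT)/andP[].
have colc e : e \in E -> e \notin K -> col e != c.
  by move=> eE eK; have := colL e; rewrite !inE eK eE => /(_ isT)/andP[].
move=> e f eE fE inc; case: ifP => eK; case: ifP => fK.
- by move=> _; apply: Km.
- by move=> cE; have := colc f fE; rewrite fK -cE eqxx => /(_ isT).
- by move=> cE; have := colc e eE; rewrite eK cE eqxx => /(_ isT).
- by apply: colP; rewrite // !inE ?eK ?fK.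
Qed.
End Galvin.

Definition swap_colors (a b n : nat) := if n == a then b else if n == b then a else n.

Lemma swap_colors_inj a b : injective (swap_colors a b).
Proof. by move=> m n; rewrite /swap_colors; do ! case: eqP => //; congruence. Qed.

Lemma connect_last (T : finType) (g : rel T) x y :
  connect g x y -> y != x -> exists2 z, connect g x z & g z y.
Proof.
case/connectP => p; elim/last_ind: p => [|p z _] /=; first by move=> _ ->; rewrite eqxx.
rewrite rcons_path last_rcons => /andP[pp gz] -> _; exists (last x p) => //.
by apply/connectP; exists p.
Qed.

Lemma konig j F :
  (forall u, #|edges_at1 F u| <= j) -> (forall w, #|edges_at2 F w| <= j) ->
  exists2 c : U * W -> nat, forall e, e \in F -> c e < j & proper_on F c.
Proof.
move: {2}#|F|.+1 (ltnSn #|F|) => n; elim: n => // n IH in F *; rewrite ltnS => le_n deg1 deg2.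
have [-> | [e0 e0F]] := set_0Vmem F.
  by exists (fun=> 0) => [e | e f]; rewrite inE.
pose F' := F :\ e0.
have F'F e : e \in F' -> e \in F by case/setD1P.
have sub1 u : edges_at1 F' u \subset edges_at1 F u.
  by apply/subsetP => e; rewrite !inE => /andP[/andP[_ ->] ->].
have sub2 w : edges_at2 F' w \subset edges_at2 F w.
  by apply/subsetP => e; rewrite !inE => /andP[/andP[_ ->] ->].
have [|u|w|c c_lt c_proper] := IH F'.
- by apply: leq_trans le_n; rewrite (cardsD1 e0 F) e0F.
- by apply: leq_trans (subset_leq_card (sub1 u)) _.
- by apply: leq_trans (subset_leq_card (sub2 w)) _.
have missing (A : {set U * W}) : #|A| < j -> exists2 a, a < j & forall e, e \in A -> c e != a.
  move=> A_lt; have [/allP all_used | /allPn[a]] := boolP (all [in [seq c e | e in A]] (iota 0 j)).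
    have := uniq_leq_size (iota_uniq 0 j) all_used.
    by rewrite size_iota size_map -cardE leqNgt A_lt.
  rewrite mem_iota => a_lt a_free; exists a => // e eA.
  by apply: contraNneq a_free => <-; apply: image_f.
have [a a_lt a_free] : exists2 a, a < j & forall e, e \in edges_at1 F' e0.1 -> c e != a.
  apply: missing; apply: leq_trans (deg1 e0.1); apply: proper_card; apply/properP; split=> //.
  by exists e0; rewrite !inE ?eqxx ?e0F.
have [b b_lt b_free] : exists2 b, b < j & forall e, e \in edges_at2 F' e0.2 -> c e != b.
  apply: missing; apply: leq_trans (deg2 e0.2); apply: proper_card; apply/properP; split=> //.
  by exists e0; rewrite !inE ?eqxx ?e0F.
(* Kempe chain of [e0.2], explored by entering [U] along color [a] and leaving it
   along color [b]: it cannot reach [e0.1], where [a] is free. *)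
pose g : rel (U + W) := fun x y => match x, y with
  | inr w, inl u => ((u, w) \in F') && (c (u, w) == a)
  | inl u, inr w => ((u, w) \in F') && (c (u, w) == b)
  | _, _ => false end.
pose K := connect g (inr e0.2).
have K1 u : K (inl u) -> exists2 w, (u, w) \in F' & c (u, w) = a /\ K (inr w).
  move=> /connect_last[//|[u' _ // | w Kw /= /andP[uwF /eqP uwa]]]; by exists w.
have K2 w : K (inr w) -> w = e0.2 \/ exists2 u, (u, w) \in F' & c (u, w) = b /\ K (inl u).
  move=> Kw; have [-> | ne] := eqVneq w e0.2; [by left | right].
  have [|[u Ku /= /andP[uwF /eqP uwb]| //]] := connect_last Kw; first by apply: contra ne => /eqP[->].
  by exists u.
have u0K : ~ K (inl e0.1).
  move=> /K1[w wF [wa _]]; have := a_free (e0.1, w); rewrite inE wF eqxx => /(_ isT).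
  by rewrite wa eqxx.
have w0K : K (inr e0.2) by apply: connect0.
have Ka u w : (u, w) \in F' -> c (u, w) = a -> K (inl u) = K (inr w).
  move=> uwF uwa; apply/idP/idP => [/K1[w' w'F [w'a Kw']] | Kw].
    by have [<-] : (u, w') = (u, w) by apply: c_proper; rewrite ?w'a ?uwa //; left.
  by apply: connect_trans Kw (connect1 _); rewrite /g uwF uwa eqxx.
have Kb u w : (u, w) \in F' -> c (u, w) = b -> K (inl u) = K (inr w).
  move=> uwF uwb; apply/idP/idP => [Ku | /K2[w0 | [u' u'F [u'b Ku']]]].
  - by apply: connect_trans Ku (connect1 _); rewrite /g uwF uwb eqxx.
  - have := b_free (u, w); rewrite inE uwF w0 eqxx => /(_ isT).
    by rewrite -w0 uwb eqxx.
  by have [<-] : (u', w) = (u, w) by apply: c_proper; rewrite ?u'b ?uwb //; right.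
pose c1 e := if K (inl e.1) then swap_colors a b (c e) else c e.
have c1E e : e \in F' -> c1 e = if K (inr e.2) then swap_colors a b (c e) else c e.
  case: e => u w uwF; rewrite /c1 /=.
  have [uwa | na] := eqVneq (c (u, w)) a; first by rewrite (Ka u w).
  have [uwb | nb] := eqVneq (c (u, w)) b; first by rewrite (Kb u w).
  by rewrite /swap_colors (negPf na) (negPf nb) !if_same.
have c1_lt e : e \in F' -> c1 e < j.
  move=> eF; have := c_lt e eF; rewrite /c1 /swap_colors.
  by case: ifP => // _; case: ifP => // _; case: ifP.
have c1_proper : proper_on F' c1.
  move=> e f eF fF [e1 | e2].
    by rewrite /c1 e1; case: ifP => _; [move/swap_colors_inj|]; apply: c_proper => //; left.
  by rewrite !c1E // e2; case: ifP => _; [move/swap_colors_inj|]; apply: c_proper => //; right.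
have c1_free e : e \in F' -> e.1 = e0.1 \/ e.2 = e0.2 -> c1 e != a.
  move=> eF [e1 | e2].
    rewrite /c1 e1; case: ifP => [/u0K // | _].
    by apply: a_free; rewrite inE eF e1 eqxx.
  rewrite c1E // e2 w0K; have : c e != b by apply: b_free; rewrite inE eF e2 eqxx.
  rewrite /swap_colors => nb; have [ca|ca] := eqVneq (c e) a; first by rewrite -ca eq_sym.
  by rewrite (negPf nb).
exists (fun e => if e == e0 then a else c1 e).
  by move=> e eF; case: eqP => // /eqP ne; apply: c1_lt; rewrite !inE ne.
move=> e f eF fF; have [-> | ne] := eqVneq e e0; have [-> // | nf] := eqVneq f e0.
- move=> inc cf; have : c1 f != a; last by rewrite -cf eqxx.
  by apply: c1_free; [rewrite !inE nf | case: inc => ->; [left | right]].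
- move=> inc cf; have : c1 e != a; last by rewrite cf eqxx.
  by apply: c1_free; [rewrite !inE ne | case: inc => ->; [left | right]].
- by apply: c1_proper; rewrite !inE ?ne ?nf.
Qed.

Lemma card_inj_iota (T : finType) (A : {set T}) (c : T -> nat) m n :
  {in A &, injective c} -> (forall x, x \in A -> m <= c x < m + n) -> #|A| <= n.
Proof.
move=> injc cA; rewrite -[n](size_iota m) cardE -(size_map c).
apply: uniq_leq_size => [|_ /mapP[x + ->]]; last by rewrite mem_enum mem_iota => /cA.
by rewrite map_inj_in_uniq ?enum_uniq // => x y; rewrite !mem_enum; apply: injc.
Qed.

Lemma alternating_list_coloring (C : finType) (c0 : C) j F (L : U * W -> {set C}) :
  (forall u, #|edges_at1 F u| <= j) -> (forall e, e \in F -> j <= #|edges_at2 F e.2|) ->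
  (forall e, e \in F -> #|edges_at2 F e.2| <= #|L e|) ->
  exists2 col, forall e, e \in F -> col e \in L e & proper_on F col.
Proof.
move=> deg1 deg2 large.
(* [F1] keeps [j] edges at every vertex of [W] and is colored by Konig's theorem.
   Edges outside [F1] come first at [W] and last at [U]; those of [F1] are ordered
   by increasing color at [U] and by decreasing color at [W]. *)
pose F1 := [set e in F | e \in take j (enum (edges_at2 F e.2))].
have F1F : F1 \subset F by apply/subsetP => e; rewrite inE => /andP[].
have at2E w : edges_at2 F1 w = [set e in take j (enum (edges_at2 F w))].
  apply/setP => e; rewrite !inE; apply/idP/idP => [/andP[/andP[_ h] /eqP <-] // | h].
  by have := mem_take h; rewrite mem_enum inE => /andP[-> /eqP ew]; rewrite ew h eqxx.
have card_at2 w : #|edges_at2 F1 w| = minn j #|edges_at2 F w|.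
  by rewrite at2E cardsE (card_uniqP (take_uniq _ (enum_uniq _))) size_take_min -cardE.
have at1_sub u : edges_at1 F1 u \subset edges_at1 F u.
  by apply/subsetP => e; rewrite !inE => /andP[/andP[-> _] ->].
have at2_sub w : edges_at2 F1 w \subset edges_at2 F w.
  by apply/subsetP => e; rewrite !inE => /andP[/andP[-> _] ->].
have [|w|c c_lt c_proper] := @konig j F1.
- by move=> u; apply: leq_trans (subset_leq_card (at1_sub u)) _.
- by rewrite card_at2 geq_minl.
clearbody F1.
pose rk e : nat := enum_rank e; pose N := #|{: U * W}|.
have rk_lt e : rk e < N by apply: ltn_ord.
have rk_inj e f : rk e = rk f -> e = f by move/val_inj/enum_rank_inj.
pose rU e := if e \in F1 then c e else j + rk e.
pose rW e := if e \in F1 then N + (j - c e) else rk e.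
apply: (@galvin rU rW C c0).
- move=> e f eF fF ef; rewrite /rU; case: ifP => eF1; case: ifP => fF1.
  + by apply: c_proper => //; left.
  + by have := c_lt e eF1; lia.
  + by have := c_lt f fF1; lia.
  + by move/addnI/rk_inj.
- move=> e f eF fF ef; rewrite /rW; case: ifP => eF1; case: ifP => fF1.
  + move/addnI => h; apply: c_proper => //; first by right.
    by have := c_lt e eF1; have := c_lt f fF1; lia.
  + by have := rk_lt f; lia.
  + by have := rk_lt e; lia.
  + by move/rk_inj.
move=> e eF; apply: leq_trans (large e eF).
have D_ge := deg2 e eF; have cardD := card_at2 e.2; rewrite (minn_idPl D_ge) in cardD.
have cardDE : #|edges_at2 F e.2 :\: edges_at2 F1 e.2| = #|edges_at2 F e.2| - j.
  by rewrite cardsD (setIidPr (at2_sub _)) cardD.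
have eA1 : e \in edges_at1 F e.1 by rewrite inE eF eqxx.
have eA2 : e \in edges_at2 F e.2 by rewrite inE eF eqxx.
have [eF1 | eF1] := boolP (e \in F1).
  have c_e := c_lt e eF1.
  have lt1 : #|[set f in edges_at1 F e.1 | rU f < rU e]| <= c e.
    have mem f : f \in [set f in edges_at1 F e.1 | rU f < rU e] ->
        [/\ f \in F1, f.1 = e.1 & c f < c e].
      rewrite in_set /rU eF1 => /andP[]; rewrite in_set => /andP[fF /eqP fe].
      by case: ifP => // _; move: c_e; clear; lia.
    apply: (@card_inj_iota _ _ c 0) => [f f' /mem[fF1 fe _] /mem[f'F1 f'e _] | f /mem[] //].
    by apply: c_proper => //; left; rewrite fe.
  have lt2 : #|[set f in edges_at2 F e.2 | rW f < rW e]| <=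
      (#|edges_at2 F e.2| - j) + (j - (c e).+1).
    pose B := [set f in edges_at2 F1 e.2 | c e < c f].
    have sub : [set f in edges_at2 F e.2 | rW f < rW e] \subset
        (edges_at2 F e.2 :\: edges_at2 F1 e.2) :|: B.
      apply/subsetP => f; rewrite !(in_setU, in_setD, in_set) /rW eF1.
      case: ifP => fF1 /andP[/andP[-> ->]] lt; rewrite ?fF1 //=.
      by have := c_lt f fF1; lia.
    apply: leq_trans (subset_leq_card sub) _; apply: leq_trans (leq_card_setU _ _) _.
    have memB f : f \in B -> [/\ f \in F1, f.2 = e.2 & c e < c f].
      by rewrite in_set => /andP[+ ->]; rewrite in_set => /andP[-> /eqP ->].
    rewrite cardDE leq_add2l; apply: (@card_inj_iota _ _ c (c e).+1).
      move=> f f' /memB[fF1 fe _] /memB[f'F1 f'e _].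
      by apply: c_proper => //; right; rewrite fe.
    by move=> f /memB[fF1 _ ->]; rewrite subnKC // c_lt.
  by move: lt1 lt2 D_ge c_e; clear; lia.
have lt1 : #|[set f in edges_at1 F e.1 | rU f < rU e]| < j.
  apply: leq_trans (deg1 e.1); apply: proper_card; apply/properP; split.
    by apply/subsetP => f; rewrite inE => /andP[].
  by exists e; rewrite // inE ltnn andbF.
have lt2 : #|[set f in edges_at2 F e.2 | rW f < rW e]| <= #|edges_at2 F e.2| - j.
  rewrite -cardDE; apply: subset_leq_card; apply/subsetP => f.
  rewrite !(in_setD, in_set) /rW (negPf eF1); case: ifP => fF1 /andP[/andP[-> ->]] lt.
    by have := rk_lt e; lia.
  by rewrite ?fF1.
by move: lt1 lt2 D_ge; clear; lia.
Qed.

End BipartiteEdgeColoring.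

(** * Extending a coloring over deleted edges *)

Lemma free_color k (s : seq nat) : size s < k -> exists2 a, 0 < a <= k & a \notin s.
Proof.
move=> s_lt; have [/allP all_used | /allPn[a]] := boolP (all (mem s) (iota 1 k)).
  by have := uniq_leq_size (iota_uniq 1 k) all_used; rewrite size_iota leqNgt s_lt.
by rewrite mem_iota => a_lt a_free; exists a => //; lia.
Qed.

Section Extension.
Variables (V : finType) (M : rel V) (k : nat) (cvH : V -> nat) (ceH : V -> V -> nat).
Local Notation P := (matching_vertices M).
Implicit Types (e D : rel V) (U S : {set V}).

Definition extendable e : Prop := exists cv ce,
  [/\ total_coloring predT e k cv ce, forall x, P x -> cv x = cvH x &
      forall x y, M x y -> ce x y = ceH x y].

Definition delete e D : rel V := [rel x y | e x y && ~~ D x y].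

Definition incident e U : rel V := [rel x y | e x y && ((x \in U) || (y \in U))].

Lemma matching_vertexl x y : M x y -> P x.
Proof. by move=> xy; apply/existsP; exists y. Qed.

Lemma extend_recoloring e D U (cv : V -> nat) (ce col : V -> V -> nat) :
  symmetric e -> symmetric M -> symmetric D ->
  {in U, forall x, ~~ P x} ->
  (forall x y, D x y -> (x \in U) || (y \in U)) ->
  {in U &, forall x y, ~~ e x y} ->
  {in U, forall x, #|nbrs e x|.*2 < k} ->
  total_coloring predT (delete e D) k cv ce ->
  (forall x, P x -> cv x = cvH x) -> (forall x y, M x y -> ce x y = ceH x y) ->
  (forall x y, D x y -> 0 < col x y <= k /\ col x y = col y x) ->
  (forall x y z, D x y -> D x z -> y != z -> col x y != col x z) ->
  (forall x y z, D x y -> delete e D x z -> col x y != ce x z) ->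
  (forall x y, D x y -> x \notin U -> col x y != cv x) ->
  extendable e.
Proof.
move=> se sM sD UP DU indep small [cvk [cek cep]] cvP ceM colk colp colce colcv.
pose ce' x y := if D x y then col x y else ce x y.
have del x y : e x y -> ~~ D x y -> delete e D x y by rewrite /delete /= => -> ->.
have sce' x y : e x y -> ce' x y = ce' y x.
  move=> xy; rewrite /ce' sD; case: ifPn => [|nD]; first by rewrite sD => /colk[].
  by have [_ ->] := cek x y (del _ _ xy (ltac:(by rewrite sD))).
have /fin_all_exists[g gP] : forall x, exists a, x \in U ->
    0 < a <= k /\ forall y, e x y -> a != cv y /\ a != ce' x y.
  move=> x; have [xU|] := boolP (x \in U); last by exists 0.
  have [|a ak a_free] := @free_color k (map cv (enum (nbrs e x)) ++ map (ce' x) (enum (nbrs e x))).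
    by rewrite size_cat !size_map -cardE addnn small.
  exists a => _; split=> // y xy; have yN : y \in enum (nbrs e x) by rewrite mem_enum inE.
  by split; apply: contraNneq a_free => ->; rewrite mem_cat map_f ?orbT.
pose cv' x := if x \in U then g x else cv x.
have cvV x y : e x y -> ce' x y != cv' x.
  rewrite /cv' => xy; have [xU | xU] := boolP (x \in U).
    by rewrite eq_sym; have [_ /(_ y xy)[]] := gP x xU.
  rewrite /ce'; case: ifPn => [Dxy | nD]; first exact: colcv.
  by have [] := cek x y (del _ _ xy nD).
exists cv', ce'; split.
- split; [|split].
  + by move=> x _; rewrite /cv'; case: ifP => [/gP[-> _] // | _]; apply: cvk.
  + move=> x y xy; have yx : e y x by rewrite se.
    have nvv : cv' x != cv' y.
      rewrite /cv'; have [xU | xU] := boolP (x \in U); have [yU | yU] := boolP (y \in U).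
      * by rewrite (negPf (indep x y xU yU)) in xy.
      * by have [_ /(_ y xy)[]] := gP x xU.
      * by rewrite eq_sym; have [_ /(_ x yx)[]] := gP y yU.
      * have nD : ~~ D x y by apply/negP => /DU; rewrite (negPf xU) (negPf yU).
        by have [] := cek x y (del _ _ xy nD).
    split=> //; [|exact: sce'|exact: cvV|by rewrite sce' // cvV].
    rewrite /ce'; case: ifPn => [/colk[] // | nD].
    by have [] := cek x y (del _ _ xy nD).
  + move=> x y z xy xz yz; rewrite /ce'; case: ifPn => Dxy; case: ifPn => Dxz.
    * exact: colp.
    * exact: colce Dxy (del _ _ xz Dxz).
    * by rewrite eq_sym; apply: colce Dxz (del _ _ xy Dxy).
    * exact: cep (del _ _ xy Dxy) (del _ _ xz Dxz) yz.
- by move=> x Px; rewrite /cv'; case: ifP => [/UP | _]; [rewrite Px | apply: cvP].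
move=> x y xy; rewrite /ce'; case: ifPn => [/DU/orP[]/UP | _]; last exact: ceM.
  by rewrite (matching_vertexl xy).
by rewrite sM in xy; rewrite (matching_vertexl xy).
Qed.

Lemma card_nbrs_rem e x y : e x y -> #|nbrs e x| = #|nbrs e x :\ y|.+1.
Proof. by move=> xy; rewrite (cardsD1 y) inE xy. Qed.

Lemma extend_light_edge e x y : symmetric e -> irreflexive e -> symmetric M ->
  e x y -> ~~ P x -> #|nbrs e x|.*2 < k -> #|nbrs e x| + #|nbrs e y| <= k ->
  extendable (delete e [rel a b | (a == x) && (b == y) || (a == y) && (b == x)]) -> extendable e.
Proof.
move=> se ie sM xy Px small light; set D := [rel a b | _] => -[cv [ce [col cvP ceM]]].
have yx : e y x by rewrite se.
have sD : symmetric D by move=> a b; rewrite /D /= orbC (andbC (a == x)) (andbC (a == y)).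
have DE a b : D a b -> (a, b) = (x, y) \/ (a, b) = (y, x).
  by move=> /orP[] /andP[/eqP-> /eqP->]; [left | right].
pose s := cv y :: map (ce x) (enum (nbrs e x :\ y)) ++ map (ce y) (enum (nbrs e y :\ x)).
have [|a ak a_free] := @free_color k s.
  rewrite /= size_cat !size_map -!cardE; move: light.
  by rewrite (card_nbrs_rem xy) (card_nbrs_rem yx) addSn addnS.
have [acv [ax ay]] : a != cv y /\ (forall z, e x z -> z != y -> a != ce x z) /\
    (forall z, e y z -> z != x -> a != ce y z).
  split; first by apply: contraNneq a_free => ->; rewrite inE eqxx.
  by split=> z ez nz; apply: contraNneq a_free => ->; rewrite inE mem_cat map_f ?orbT // mem_enum !inE nz ez.
apply: (@extend_recoloring e D [set x] cv ce (fun _ _ => a)) => //.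
- by move=> z /set1P->.
- by move=> z t /DE[] [-> ->]; rewrite !inE eqxx ?orbT.
- by move=> z t /set1P-> /set1P->; rewrite ie.
- by move=> z /set1P->.
- move=> z t u /DE zt /DE zu.
  by case: zt => -[zx ->]; case: zu => -[zx' ->]; rewrite -?zx -?zx' eqxx.
- move=> z t u /DE[] [-> _]; rewrite /delete /D /= eqxx /= => /andP[eu].
    by rewrite negb_or => /andP[nu _]; apply: ax.
  by rewrite negb_or => /andP[_ nu]; apply: ay.
- by move=> z t /DE[] [-> _]; rewrite inE ?eqxx.
Qed.

Lemma extend_alternating e U j : symmetric e -> symmetric M ->
  {in U, forall x, ~~ P x} -> {in U &, forall x y, ~~ e x y} ->
  {in U, forall x, #|nbrs e x|.*2 < k} -> {in U, forall x, #|nbrs e x| <= j} ->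
  (forall w, #|nbrs e w| < k) ->
  (forall u w, u \in U -> e u w -> j <= #|nbrs e w :&: U|) ->
  extendable (delete e (incident e U)) -> extendable e.
Proof.
move=> se sM UP indep small deg_j deg_k alt [cv [ce [col cvP ceM]]].
pose F := [set p : V * V | (p.1 \in U) && e p.1 p.2].
have deg1 u : #|edges_at1 F u| <= j.
  have [uU | uU] := boolP (u \in U).
    apply: leq_trans (deg_j u uU); rewrite -(card_imset (nbrs e u) (_ : injective (fun w => (u, w)))).
      apply: subset_leq_card; apply/subsetP => -[a b]; rewrite !inE /= => /andP[/andP[aU ab] /eqP au].
      by apply/imsetP; exists b; rewrite ?au // inE -au.
    by move=> ? ? [].
  rewrite (_ : edges_at1 F u = set0) ?cards0 //; apply/setP => -[a b]; rewrite !inE /=.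
  by apply/negP => /andP[/andP[aU _] /eqP au]; rewrite -au aU in uU.
have deg2 w : #|edges_at2 F w| = #|nbrs e w :&: U|.
  rewrite -(card_imset (nbrs e w :&: U) (_ : injective (fun u => (u, w)))); last by move=> ? ? [].
  apply: eq_card => -[a b]; rewrite !inE /=; apply/idP/imsetP => [/andP[/andP[aU ab] /eqP bw]|].
    by exists a; rewrite ?bw // !inE aU -bw se ab.
  by case=> u + [-> ->]; rewrite !inE eqxx andbT => /andP[wu ->]; rewrite se.
pose L (p : V * V) := [set c : 'I_k.+1 | [&& 0 < c, nat_of_ord c != cv p.2 &
  [forall z in nbrs e p.2 :\: U, nat_of_ord c != ce p.2 z]]].
have L_large p : p \in F -> #|edges_at2 F p.2| <= #|L p|.
  case: p => u w; rewrite inE => /andP[/= uU uw]; rewrite deg2.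
  have : ~: L (u, w) \subset [set ord0; inord (cv w)] :|: [set inord (ce w z) | z in nbrs e w :\: U].
    apply/subsetP => c; rewrite !inE /= negb_and -eqn0Ngt !negb_and negbK.
    case/or3P=> [/eqP c0 | /eqP cw | /forall_inPn[z zN]].
    - by apply/orP; left; apply/orP; left; apply/eqP/val_inj.
    - by apply/orP; left; apply/orP; right; rewrite -cw inord_val.
    - rewrite negbK => /eqP cz; apply/orP; right; apply/imsetP; exists z => //.
      by rewrite -cz inord_val.
  move/subset_leq_card => /leq_trans/(_ (leq_card_setU _ _)).
  have := leq_imset_card (fun z => inord (ce w z) : 'I_k.+1) (nbrs e w :\: U).
  have := cardsC (L (u, w)); rewrite card_ord cards2.
  have := cardsID U (nbrs e w); have := deg_k w.
  by clear; case: (_ != _) => /=; lia.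
have [p pF|col' colL col_proper] := alternating_list_coloring ord0 deg1 _ L_large.
  by case: p pF => u w; rewrite inE => /andP[/= uU uw]; rewrite deg2; apply: alt uw.
have FE u w : ((u, w) \in F) = (u \in U) && e u w by rewrite inE.
have LE u w : u \in U -> e u w -> [/\ 0 < col' (u, w), nat_of_ord (col' (u, w)) != cv w &
    forall z, e w z -> z \notin U -> nat_of_ord (col' (u, w)) != ce w z].
  move=> uU uw; have := colL (u, w); rewrite FE uU uw inE => /(_ isT)/and3P[-> -> /forall_inP h].
  by split=> // z wz zU; apply: h; rewrite !inE wz zU.
pose clr x y : nat := if x \in U then col' (x, y) else col' (y, x).
have DU x y : incident e U x y -> (x \in U) || (y \in U) by case/andP.
have De x y : incident e U x y -> e x y by case/andP.
apply: (@extend_recoloring e (incident e U) U cv ce clr) => //.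
- by move=> x y; rewrite /incident /= se orbC.
- move=> x y xy; have /orP[xU | yU] := DU _ _ xy.
    have yU : y \notin U by apply: contraL (De _ _ xy) => /(indep x y xU).
    rewrite /clr xU (negPf yU); split=> //.
    by have [-> _ _] := LE x y xU (De _ _ xy); rewrite -ltnS ltn_ord.
  have xU : x \notin U by apply: contraL (De _ _ xy) => xU; apply: indep.
  rewrite /clr yU (negPf xU); split=> //.
  have yx : e y x by rewrite se De.
  by have [-> _ _] := LE y x yU yx; rewrite -ltnS ltn_ord.
- move=> x y z xy xz; apply: contra => /eqP /val_inj; rewrite /clr.
  have := De _ _ xy; have := De _ _ xz => exz exy.
  case: ifPn => xU.
    by move/col_proper; rewrite !FE xU exz exy => /(_ isT isT (or_introl erefl))[->].
  have := DU _ _ xy; have := DU _ _ xz; rewrite (negPf xU) /= => zU yU.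
  have eyx : e y x by rewrite se. have ezx : e z x by rewrite se.
  by move/col_proper; rewrite !FE yU zU eyx ezx => /(_ isT isT (or_intror erefl))[->].
- move=> x y z xy /andP[exz]; rewrite /incident /= exz negb_or => /andP[xU zU].
  have := DU _ _ xy; rewrite /clr (negPf xU) /= => yU.
  have eyx : e y x by rewrite se De.
  by have [_ _] := LE y x yU eyx; apply.
- move=> x y xy xU; have := DU _ _ xy; rewrite /clr (negPf xU) /= => yU.
  have eyx : e y x by rewrite se De.
  by have [_ ] := LE y x yU eyx.
Qed.

End Extension.

Lemma card_peeled (V : finType) (e : rel V) (j : nat) (Y W : {set V}) : symmetric e ->
  (forall u w, u \in Y -> e u w -> w \in W) ->
  (forall U : {set V}, U \subset Y -> U != set0 ->
     exists u w, [/\ u \in U, e u w & #|nbrs e w :&: U| <= j]) ->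
  #|Y| <= j * #|W|.
Proof.
move=> se; move: {2}#|Y|.+1 (ltnSn #|Y|) => n; elim: n => // n IH in Y W *.
rewrite ltnS => le_n YW peel; have [-> | Y0] := eqVneq Y set0; first by rewrite cards0.
have [u [w [uY uw light]]] := peel Y (subxx Y) Y0.
have wW := YW u w uY uw.
have uN : u \in nbrs e w :&: Y by rewrite !inE se uw.
have le : #|Y :\: nbrs e w| <= j * #|W :\ w|.
  apply: IH => [|u' w' /setDP[u'Y u'w] u'w'|U UY].
  - apply: leq_trans le_n; apply: proper_card; apply/properP; split; first exact: subsetDl.
    by exists u => //; rewrite !inE se uw.
  - rewrite !inE (YW u' w') // andbT; apply: contraNneq u'w => <-; by rewrite inE se.
  - by apply: peel; apply: subset_trans UY (subsetDl _ _).
rewrite -(cardsID (nbrs e w) Y) setIC (cardsD1 w W) wW mulnDr muln1.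
exact: leq_add.
Qed.

(** * Discharging *)

Section Main.
Variables (V : finType) (M : rel V) (k : nat) (cvH : V -> nat) (ceH : V -> V -> nat).
Local Notation P := (matching_vertices M).
Local Notation extendable := (extendable M k cvH ceH).
Implicit Types (e D : rel V) (U S : {set V}).

Lemma sum_degree_K5_minor_free e S : symmetric e -> irreflexive e -> ~ K5_minor e -> S != set0 ->
  \sum_(v in S) #|nbrs e v :&: S| < 6 * #|S|.
Proof.
move=> se ie noK5 S0.
have -> : \sum_(v in S) #|nbrs e v :&: S| = #|edge_pairs (restrict e S)|.
  rewrite card_edge_pairs [RHS](bigID (mem S)) /= [X in _ = _ + X]big1 ?addn0.
    apply: eq_bigr => v vS; apply: eq_card => w; rewrite !inE /restrict /= vS.
    by rewrite andbC.
  move=> v vS; apply/eqP; rewrite cards_eq0; apply/eqP/setP => w.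
  by rewrite !inE /restrict /= (negPf vS).
have S_gt0 : 0 < #|S| by rewrite card_gt0.
have [S3 | S2] := ltnP 2 #|S|.
  rewrite ltnNge; apply/negP => dense; apply: noK5.
  apply: (@K5_minorW _ e (restrict e S)); first by move=> x y /and3P[].
  apply: (@mader_K5 _ _ S) => //.
  - by move=> x y; rewrite /restrict /= se andbCA.
  - by move=> x; rewrite /restrict /= ie !andbF.
  - by move=> x y /and3P[].
  - by apply: leq_trans dense (leq_addr _ _).
apply: (@leq_ltn_trans (#|S| * #|S|)); last by rewrite ltn_mul2r S_gt0 (leq_ltn_trans S2).
rewrite -cardsX; apply: subset_leq_card; apply/subsetP => -[x y].
by rewrite !inE /restrict /= => /and3P[-> ->].
Qed.

Lemma distance3_adjacent e x z : irreflexive e -> distance3_matching e M ->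
  P x -> P z -> e x z -> M x z.
Proof.
move=> ie [sM [_ [_ far]]] /existsP[x' xx'] /existsP[z' zz'] xz.
have [xzE | nxz] := eqVneq x z; first by rewrite xzE ie in xz.
have [-> | nxz'] := eqVneq x z'; first by rewrite sM.
by have [nxz1 _ _ _] := far x x' z z' xx' zz' nxz nxz'; rewrite xz in nxz1.
Qed.

Lemma distance3_common_nbr e x y z : symmetric e -> distance3_matching e M ->
  P x -> P z -> e y x -> e y z -> x = z \/ M x z.
Proof.
move=> se [sM [_ [_ far]]] /existsP[x' xx'] /existsP[z' zz'] yx yz.
have [-> | nxz] := eqVneq x z; [by left | right].
have [-> | nxz'] := eqVneq x z'; first by rewrite sM.
have [_ _ /(_ y) + _] := far x x' z z' xx' zz' nxz nxz'.
by rewrite se yx yz.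
Qed.

Lemma distance3_delete e D : (forall x y, M x y -> ~~ D x y) ->
  distance3_matching e M -> distance3_matching (delete e D) M.
Proof.
move=> MD [sM [Me [mM far]]]; split=> //; split; last split=> //.
  by move=> x y xy; rewrite /delete /= Me // MD.
move=> x y u w xy uw xu xw; have [a b c d] := far x y u w xy uw xu xw.
split=> [||z|z]; rewrite /delete /=.
- by rewrite (negPf a).
- by rewrite (negPf b).
- by apply: contra (c z) => /andP[/andP[-> _] /andP[-> _]].
- by apply: contra (d z) => /andP[/andP[-> _] /andP[-> _]].
Qed.

Hypothesis k28 : 28 <= k.
Hypothesis colH : total_coloring P M k cvH ceH.

Lemma extend_matching_only e : symmetric M -> (forall x y, e x y -> M x y) -> extendable e.
Proof.
move=> sM eM; have [cvk [cek cep]] := colH.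
exists (fun x => if P x then cvH x else 1), ceH; split=> //; last by move=> x ->.
split; [|split].
- by move=> x _; case: ifP => [/cvk // | _]; apply: leq_trans k28.
- move=> x y /eM xy; have [xk s n nx ny] := cek x y xy.
  have Px : P x by apply: matching_vertexl xy.
  have Py : P y by apply: (@matching_vertexl _ _ y x); rewrite sM.
  by rewrite Px Py.
- by move=> x y z /eM xy /eM xz; apply: cep.
Qed.

Theorem extend_sparse e : symmetric e -> irreflexive e -> ~ K5_minor e ->
  (forall v, #|nbrs e v| < k) -> distance3_matching e M -> extendable e.
Proof.
move: {2}#|edge_pairs e|.+1 (ltnSn #|edge_pairs e|) => n.
elim: n => // n IH in e *; rewrite ltnS => le_n se ie noK5 deg_k dist.
have [sM [Me [mM _]]] := dist.
have {}IH D : symmetric D -> (exists x y, e x y && D x y) -> (forall x y, M x y -> ~~ D x y) ->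
    extendable (delete e D).
  move=> sD [x0 [y0 /andP[xy0 Dxy0]]] MD; apply: IH.
  - apply: leq_trans le_n; apply: proper_card; apply/properP; split.
      by apply/subsetP => p; rewrite !inE => /andP[].
    by exists (x0, y0); rewrite !inE /delete /= ?xy0 ?Dxy0.
  - by move=> x y; rewrite /delete /= se sD.
  - by move=> x; rewrite /delete /= ie.
  - by apply: contra_not noK5; apply: K5_minorW => x y /andP[].
  - move=> v; apply: leq_ltn_trans (deg_k v); apply: subset_leq_card; apply/subsetP => w.
    by rewrite !inE => /andP[].
  - exact: distance3_delete.
apply: contrapT => not_ext.
have nM x y : ~~ P x -> ~~ M x y by apply: contra => /matching_vertexl.
have heavy x y : e x y -> ~~ P x -> #|nbrs e x|.*2 < k -> k < #|nbrs e x| + #|nbrs e y|.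
  move=> xy Px small; rewrite ltnNge; apply/negP => light; apply: not_ext.
  apply: (extend_light_edge (x := x) (y := y)) => //; apply: IH.
  - by move=> a b; rewrite /= orbC (andbC (a == x)) (andbC (a == y)).
  - by exists x, y; rewrite xy /= !eqxx.
  - move=> a b ab; apply/negP => /orP[] /andP[/eqP aE /eqP bE].
      by rewrite aE in ab; rewrite (negPf (nM x b Px)) in ab.
    by rewrite sM bE in ab; rewrite (negPf (nM x a Px)) in ab.
pose deg v := #|nbrs e v|.
pose Y j := [set v | ~~ P v && (0 < deg v <= j)].
pose W := [set v | 24 <= deg v].
pose S := [set v | if P v then 6 < deg v else 0 < deg v].
have Y_nbr j u w : j <= 5 -> u \in Y j -> e u w -> w \in W.
  rewrite !inE => j5 /andP[Pu /andP[_ uj]] uw; have := heavy u w uw Pu.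
  by rewrite -/(deg u) -/(deg w); move: (deg u) (deg w) uj j5 k28 => a b; clear; lia.
have deg_pos x y : e x y -> 0 < deg x by move=> xy; apply/card_gt0P; exists y; rewrite inE.
have card_Y j : 1 < j <= 5 -> #|Y j| <= j.-1 * #|W|.
  move=> /andP[j1 j5]; apply: (card_peeled se); first by move=> u w; apply: Y_nbr.
  move=> U /subsetP UY U0; apply: contrapT => no_light; apply: not_ext.
  have UP : {in U, forall x, ~~ P x} by move=> x /UY; rewrite inE => /andP[].
  have Udeg x : x \in U -> 0 < deg x <= j by move=> /UY; rewrite inE => /andP[].
  have [x xU] := set0Pn _ U0.
  apply: (extend_alternating (U := U) (j := j)) => //.
  - move=> a b aU bU; apply/negP => ab; have := Y_nbr j a b j5 (UY a aU) ab.
    by rewrite inE; have := Udeg b bU; move: (deg b) j5; clear; lia.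
  - move=> a /Udeg; rewrite -/(deg a); move: (deg a) j5 k28; clear; lia.
  - by move=> a /Udeg/andP[].
  - move=> u w uU uw; rewrite leqNgt; apply/negP => lt; apply: no_light.
    by exists u, w; split=> //; move: lt j1; clear; lia.
  apply: IH.
  - by move=> a b; rewrite /incident /= se orbC.
  - have /andP[/card_gt0P[y yN] _] := Udeg x xU; have xy : e x y by rewrite inE in yN.
    by exists x, y; rewrite /incident /= xy xU.
  - move=> a b ab; apply/negP => /andP[_ /orP[] /UP].
      by rewrite (matching_vertexl ab).
    by rewrite sM in ab; rewrite (matching_vertexl ab).
have S0 : S != set0.
  apply/eqP => S0; apply: not_ext; apply: extend_matching_only => // x y xy.
  have inP a b : e a b -> P a.
    move=> ab; apply: contraT => Pa; have /setP/(_ a) := S0.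
    by rewrite !inE (negPf Pa) (deg_pos _ _ ab).
  by apply: (distance3_adjacent ie dist) => //; [apply: inP xy | apply: (inP y x); rewrite se].
have WS : W \subset S.
  by apply/subsetP => v; rewrite !inE => h; case: ifP => _; apply: leq_trans h.
have := sum_degree_K5_minor_free se ie noK5 S0; rewrite ltnNge => /negP; apply.
(* On [Y 5], [f v] is [6 - deg v]. *)
pose f v : nat := (v \in Y 2) + (v \in Y 3) + (v \in Y 4) + (v \in Y 5).
have not_S v w : e v w -> w \notin S -> P w /\ deg w <= 6.
  move=> vw; rewrite inE; case: ifP => [_ | _]; first by rewrite -leqNgt.
  by rewrite se in vw; rewrite (deg_pos _ _ vw).
have card_notS v m : #|nbrs e v :\: S| <= m -> deg v <= #|nbrs e v :&: S| + m.
  by rewrite /deg -(cardsID S (nbrs e v)) leq_add2l.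
have nbr_notS v x : x \in nbrs e v :\: S -> e v x /\ x \notin S.
  by case/setDP; rewrite inE.
have local v : v \in S -> 6 + (v \in W) * 10 <= #|nbrs e v :&: S| + f v.
  move=> vS; have [sub | /subsetPn[x]] := boolP (nbrs e v \subset S).
    rewrite (setIidPl sub) -/(deg v).
    have [Pv | Pv] := boolP (P v).
      have : 6 < deg v by move: vS; rewrite inE Pv.
      by rewrite [v \in W]inE; move: (deg v) (f v); clear; lia.
    have dv : 0 < deg v by move: vS; rewrite inE (negPf Pv).
    have dv1 : deg v != 1.
      have /card_gt0P[w] := dv; rewrite inE => vw; apply/eqP => d1.
      have := heavy v w vw Pv; rewrite -/(deg v) d1 => /(_ (leq_trans (isT : 2 < 28) k28)).
      by rewrite ltnNge addSn add0n deg_k.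
    rewrite /f !inE Pv dv /=; move: (deg v) dv dv1; clear; lia.
  rewrite [x \in nbrs e v]inE => vx xS; have [Px dx] := not_S v x vx xS.
  have [Pv | Pv] := boolP (P v).
    have dv : 6 < deg v by move: vS; rewrite inE Pv.
    have : deg v <= #|nbrs e v :&: S| + 1.
      apply: card_notS; have sub : nbrs e v :\: S \subset [set x].
        apply/subsetP => y /nbr_notS[vy yS]; have [Py _] := not_S v y vy yS.
        by rewrite inE; apply/eqP/(mM v); apply: (distance3_adjacent ie dist).
      by apply: leq_trans (subset_leq_card sub) _; rewrite cards1.
    rewrite [v \in W]inE; move: (#|_ :&: _|) (f v) (deg v) dv; clear; lia.
  have big_v : 14 <= deg v.
    rewrite leqNgt; apply/negP => lt; have := heavy v x vx Pv.
    by rewrite -/(deg v) -/(deg x); move: (deg v) (deg x) lt dx k28 => a b; clear; lia.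
  have /existsP[x' xx'] := Px.
  have : deg v <= #|nbrs e v :&: S| + 2.
    apply: card_notS.
    have sub : nbrs e v :\: S \subset [set x; x'].
      apply/subsetP => y /nbr_notS[vy yS]; have [Py _] := not_S v y vy yS.
      have [-> | xy] := distance3_common_nbr se dist Px Py vx vy; first by rewrite !inE eqxx.
      by rewrite !inE (mM _ _ _ xy xx') eqxx orbT.
    by apply: leq_trans (subset_leq_card sub) _; rewrite cards2; case: (_ != _).
  rewrite [v \in W]inE; move: (#|_ :&: _|) (f v) (deg v) big_v; clear; lia.
have sum_mem (A : {set V}) : \sum_(v in S) (v \in A : nat) = #|S :&: A|.
  by rewrite -big_mkcondr /= sum1_card; apply: eq_card => v; rewrite in_setI.
have sum_mem_le (A : {set V}) : \sum_(v in S) (v \in A : nat) <= #|A|.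
  by rewrite sum_mem subset_leq_card // subsetIr.
have sum_f : \sum_(v in S) f v <= 10 * #|W|.
  rewrite /f !big_split /=.
  have := card_Y 2 isT; have := card_Y 3 isT; have := card_Y 4 isT; have := card_Y 5 isT.
  have := sum_mem_le (Y 2); have := sum_mem_le (Y 3); have := sum_mem_le (Y 4); have := sum_mem_le (Y 5).
  move: (\sum_(_ in _) _) => a5; move: (\sum_(_ in _) _) => a4; move: (\sum_(_ in _) _) => a3.
  move: (\sum_(_ in _) _) => a2; clear; lia.
clearbody f.
have : \sum_(v in S) (6 + (v \in W) * 10) <= \sum_(v in S) (#|nbrs e v :&: S| + f v).
  exact: leq_sum.
rewrite !big_split /= sum_nat_const.
have -> : \sum_(v in S) (v \in W) * 10 = #|W| * 10.
  by rewrite -big_distrl /= sum_mem (setIidPr WS).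
by move: sum_f; clear; lia.
Qed.
End Main.

(** * Drawings of K5 by discrete paths *)

From mathcomp Require Import all_order all_algebra lra.
From Stdlib Require Import Btauto.
Import Order.TTheory GRing.Theory Num.Theory.

(** Every [w i j k] occurs in exactly two of the fifteen equations. *)
Lemma K5_parity (w : nat -> nat -> nat -> bool) (u : nat -> nat -> bool) :
  (forall i j, (i < j < 5)%N -> u j i = ~~ u i j) ->
  (forall i j k l, (i < j < 5)%N -> (k < l < 5)%N -> uniq [:: i; j; k; l] ->
    w i j k (+) w i j l (+) (w k l i (+) w k l j) = u k i (+) u l i (+) (u k j (+) u l j)) ->
  False.
Proof.
move=> uN eqw.
have e0 := eqw 0 1 2 3 isT isT isT.
have e1 := eqw 0 1 2 4 isT isT isT.
have e2 := eqw 0 1 3 4 isT isT isT.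
have e3 := eqw 0 2 1 3 isT isT isT.
have e4 := eqw 0 2 1 4 isT isT isT.
have e5 := eqw 0 2 3 4 isT isT isT.
have e6 := eqw 0 3 1 2 isT isT isT.
have e7 := eqw 0 3 1 4 isT isT isT.
have e8 := eqw 0 3 2 4 isT isT isT.
have e9 := eqw 0 4 1 2 isT isT isT.
have e10 := eqw 0 4 1 3 isT isT isT.
have e11 := eqw 0 4 2 3 isT isT isT.
have e12 := eqw 1 2 3 4 isT isT isT.
have e13 := eqw 1 3 2 4 isT isT isT.
have e14 := eqw 1 4 2 3 isT isT isT.
have u01 := uN 0 1 isT.
have u02 := uN 0 2 isT.
have u03 := uN 0 3 isT.
have u04 := uN 0 4 isT.
have u12 := uN 1 2 isT.
have u13 := uN 1 3 isT.
have u14 := uN 1 4 isT.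
have u23 := uN 2 3 isT.
have u24 := uN 2 4 isT.
have u34 := uN 3 4 isT.
move: {eqw uN} e0 e1 e2 e3 e4 e5 e6 e7 e8 e9 e10 e11 e12 e13 e14.
rewrite ?u01 ?u02 ?u03 ?u04 ?u12 ?u13 ?u14 ?u23 ?u24 ?u34.
move=> e0 e1 e2 e3 e4 e5 e6 e7 e8 e9 e10 e11 e12 e13 e14.
clear u01 u02 u03 u04 u12 u13 u14 u23 u24 u34.
have := e0; move/(congr2 addb e1); move/(congr2 addb e2); move/(congr2 addb e3); move/(congr2 addb e4);
  move/(congr2 addb e5); move/(congr2 addb e6); move/(congr2 addb e7); move/(congr2 addb e8); move/(congr2 addb e9);
  move/(congr2 addb e10); move/(congr2 addb e11); move/(congr2 addb e12); move/(congr2 addb e13); move/(congr2 addb e14).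
have addbE b c : b (+) c = xorb b c by case: b c => -[].
rewrite !addbE => e; clear -e.
have contra a b : a = false -> b = true -> a = b -> False by move=> -> ->.
by apply: contra e; btauto.
Qed.

Section DiscretePaths.
Local Open Scope ring_scope.
Variable R : realDomainType.
Implicit Types (r : R) (p q z a b d : (R * R)%type) (s : seq (R * R)).

(** Of two opposite nonzero vectors exactly one is [upper]. *)
Definition upper p : bool := (0 < p.2) || ((p.2 == 0) && (0 < p.1)).

(** Whether a short step from [p] to [q] crosses the positive x-axis. *)
Definition ray_cross p q : bool := (0 < p.1) && (upper p (+) upper q).

Definition box_close (r : R) p q : bool :=
  [&& p.1 - q.1 < r, q.1 - p.1 < r, p.2 - q.2 < r & q.2 - p.2 < r].

Definition box_far (r : R) p q : bool :=
  [|| r <= p.1 - q.1, r <= q.1 - p.1, r <= p.2 - q.2 | r <= q.2 - p.2].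

Lemma box_farE r p q : box_far r p q = ~~ box_close r p q.
Proof. by rewrite /box_far /box_close !negb_and !leNgt. Qed.

Lemma box_close_sym r p q : box_close r p q = box_close r q p.
Proof. by apply/and4P/and4P => -[*]; split. Qed.

Let close_trichotomy r (a b c : R) : 0 <= a -> b <= 0 -> c - b < r -> a - c < r -> - r < c < r.
Proof. by move=> a0 b0 cb ac; apply/andP; split; lra. Qed.

Let far_horizontal r p : box_far r p 0 -> - r < p.2 < r -> (r <= p.1) || (p.1 <= - r).
Proof.
case: p => [x y]; rewrite /box_far /= !subr0 !sub0r lerNr => fp /andP[y1 y2]; move: fp.
by rewrite [r <= - y]lerNr !leNgt y1 y2 !orbF.
Qed.

Let same_side r (a b : R) : 0 < r -> (r <= a) || (a <= - r) -> (r <= b) || (b <= - r) ->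
  a - b < r -> b - a < r -> (0 < b) = (0 < a).
Proof. by move=> r0 /orP[] ha /orP[] hb ab ba; apply/idP/idP => h; lra. Qed.

Lemma upper_sign p q : upper p != upper q -> (0 <= p.2 /\ q.2 <= 0) \/ (0 <= q.2 /\ p.2 <= 0).
Proof.
rewrite /upper; case: (ltrgt0P p.2) => hp; case: (ltrgt0P q.2) => hq //= _;
by rewrite ?hp ?hq ?lexx; auto using ltW.
Qed.

Lemma box_close_same_side r p q z : 0 < r ->
  box_far r p 0 -> box_far r z 0 -> box_close r p q -> box_close r p z -> box_close r q z ->
  upper p != upper q -> (0 < z.1) = (0 < p.1).
Proof.
move=> r0 fp fz /and4P[_ _ pq qp] /and4P[pz1 zp1 pz zp] /and4P[_ _ qz zq] /upper_sign neq.
have pp : p.2 - p.2 < r by rewrite subrr.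
have hp : - r < p.2 < r.
  by case: neq => -[h1 h2]; [apply: close_trichotomy h1 h2 _ _ | apply: close_trichotomy h1 h2 _ _].
have hz : - r < z.2 < r.
  by case: neq => -[h1 h2]; [apply: close_trichotomy h1 h2 _ _ | apply: close_trichotomy h1 h2 _ _].
by apply: (same_side r0) => //; apply: far_horizontal.
Qed.

Lemma ray_cross_cell r a b c d : 0 < r ->
  box_far r a 0 -> box_far r b 0 -> box_far r c 0 -> box_far r d 0 ->
  box_close r a b -> box_close r a c -> box_close r a d ->
  box_close r b c -> box_close r b d -> box_close r c d ->
  ray_cross a b (+) ray_cross c d = ray_cross a c (+) ray_cross b d.
Proof.
move=> r0 fa fb fc fd ab ac ad bc bd cd; rewrite /ray_cross.
have right p q z : box_far r p 0 -> box_far r q 0 -> box_far r z 0 ->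
    box_close r p q -> box_close r p z -> box_close r q z -> upper p != upper q ->
    (0 < z.1) = (0 < p.1) by move=> *; apply: (@box_close_same_side r p q z).
have rr p : box_close r p p by rewrite /box_close !subrr r0.
have sym := box_close_sym r.
have [eab|nab] := eqVneq (upper a) (upper b); last first.
  rewrite (right a b b) ?(right a b c) ?(right a b d) // ?(sym b a) //.
  by case: (0 < a.1) => //=; case: (upper a) (upper b) (upper c) (upper d) => -[] [] [].
have [eac|nac] := eqVneq (upper a) (upper c); last first.
  rewrite (right a c b) ?(right a c c) ?(right a c d) // ?(sym c b) //.
  by case: (0 < a.1) => //=; case: (upper a) (upper b) (upper c) (upper d) => -[] [] [].
have [ead|nad] := eqVneq (upper a) (upper d); last first.
  rewrite (right a d b) ?(right a d c) ?(right a d d) // ?(sym d b) ?(sym d c) //.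
  by case: (0 < a.1) => //=; case: (upper a) (upper b) (upper c) (upper d) => -[] [] [].
by rewrite -eab -eac -ead addbb !andbF.
Qed.

Lemma upperN a : a != 0 -> upper (- a) = ~~ upper a.
Proof.
case: a => a1 a2; rewrite /upper /= xpair_eqE negb_and oppr_eq0 !oppr_gt0.
by case: (ltrgt0P a2) => //= _; case: (ltrgt0P a1).
Qed.

Lemma ray_crossN r a b : 0 < r -> box_far r a 0 -> box_far r b 0 -> box_close r a b ->
  ray_cross (- a) (- b) = ray_cross a b (+) (upper a (+) upper b).
Proof.
move=> r0 fa fb ab.
have nz p : box_far r p 0 -> p != 0.
  by move=> fp; apply: contraTneq fp => ->; rewrite /box_far !subrr leNgt r0.
rewrite /ray_cross !upperN ?nz //=.
have [->|nab] := eqVneq (upper a) (upper b); first by rewrite !addbb !andbF.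
have : a.1 != 0.
  move: ab => /and4P[_ _ ab ba].
  have /(far_horizontal fa) : - r < a.2 < r.
    by case: (upper_sign nab) => -[h1 h2]; apply: close_trichotomy h1 h2 _ _; rewrite ?subrr.
  by apply: contraTneq => ->; rewrite negb_or -!ltNge oppr_lt0 r0.
by rewrite oppr_gt0; case: (ltrgt0P a.1) => //= _; case: (upper a) (upper b) => -[].
Qed.

Fixpoint path_sum (g : R * R -> R * R -> bool) p s : bool :=
  if s is q :: s' then g p q (+) path_sum g q s' else false.

Definition winding p s q : bool := path_sum (fun a b => ray_cross (a - q) (b - q)) p s.

Lemma box_far_sub r p q : box_far r (p - q) 0 = box_far r p q.
Proof. by case: p q => [p1 p2] [q1 q2]; rewrite /box_far /= !subr0 !sub0r !opprB. Qed.

Lemma winding_reversed r p s q : 0 < r -> path (box_close r) p s -> all (box_far r ^~ q) (p :: s) ->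
  path_sum (fun a b => ray_cross (q - a) (q - b)) p s =
  winding p s q (+) (upper (p - q) (+) upper (last p s - q)).
Proof.
move=> r0; elim: s p => [|a s IH] p /=; first by rewrite addbb.
move=> /andP[pa pth] /and3P[fp fa fs].
rewrite (IH a) //=; last by rewrite fa.
have close_sub x y z : box_close r (x - z) (y - z) = box_close r x y.
  by case: x y z => [? ?] [? ?] [? ?]; rewrite /box_close /= !opprB !addrA !subrK.
have := @ray_crossN r (p - q) (a - q) r0; rewrite !box_far_sub !opprB => -> //; last by rewrite close_sub.
rewrite [winding p _ q]/(_ (+) winding a s q).
by case: (ray_cross _ _); case: (winding _ _ _); case: (upper (p - q));
  case: (upper (a - q)); case: (upper _).
Qed.
Lemma box_close_sub r a b c d : box_close r a b -> box_close r c d -> box_close (r + r) (a - c) (b - d).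
Proof.
case: a b c d => [? ?] [? ?] [? ?] [? ?]; rewrite /box_close /=.
by move=> /and4P[? ? ? ?] /and4P[? ? ? ?]; apply/and4P; split; lra.
Qed.

Lemma box_close_refl r a : 0 < r -> box_close r a a.
Proof. by move=> r0; rewrite /box_close !subrr r0. Qed.

Lemma box_close_widen r a b : 0 < r -> box_close r a b -> box_close (r + r) a b.
Proof. by move=> r0 /and4P[? ? ? ?]; apply/and4P; split; lra. Qed.

Lemma winding_grid r p s q t : 0 < r ->
  path (box_close r) p s -> path (box_close r) q t ->
  all (fun a => all (box_far (r + r) a) (q :: t)) (p :: s) ->
  winding p s q (+) winding p s (last q t) =
  path_sum (fun b c => ray_cross (p - b) (p - c)) q t (+)
  path_sum (fun b c => ray_cross (last p s - b) (last p s - c)) q t.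
Proof.
move=> r0 + qt; have rr0 : 0 < r + r by rewrite addr_gt0.
elim: s p => [|p' s IH] p; first by rewrite /= addbb.
rewrite [path _ _ _]/= => /andP[pp' ps] /andP[fp /[dup] fs /andP[fp' _]].
have {IH ps fs} := IH _ ps fs; rewrite [last p _]/=.
rewrite ![winding p _ _]/(_ (+) winding p' s _).
suff -> : path_sum (fun b c => ray_cross (p - b) (p - c)) q t =
  path_sum (fun b c => ray_cross (p' - b) (p' - c)) q t (+)
  (ray_cross (p - q) (p' - q) (+) ray_cross (p - last q t) (p' - last q t)).
  case: (winding _ _ _); case: (winding _ _ _); do 2 case: (path_sum _ _ _) => //=;
  by do 2 case: (ray_cross _ _).
elim: t q fp fp' qt => [|q' t IH] q /=; first by rewrite addbb.
move=> /and3P[fpq fpq' fpt] /and3P[fp'q fp'q' fp't] /andP[qq' q't].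
rewrite {}IH //= ?fpq' ?fp'q' //.
have := @ray_cross_cell (r + r) (p - q) (p' - q) (p - q') (p' - q') rr0.
rewrite !box_far_sub => /(_ fpq fp'q fpq' fp'q').
have cr := fun a => box_close_refl a r0; have cs := box_close_sym r.
do 6 (move=> /(_ ltac:(by apply: box_close_sub => //; rewrite cs))).
case: (path_sum _ _ _); case: (ray_cross (p - q) (p' - q)); case: (ray_cross (p - q) _);
by case: (ray_cross (p' - q) _); case: (ray_cross (p - q') _); case: (ray_cross _ _).
Qed.

Lemma winding_far_paths r p s q t : 0 < r ->
  path (box_close r) p s -> path (box_close r) q t ->
  all (fun a => all (box_far (r + r) a) (q :: t)) (p :: s) ->
  winding p s q (+) winding p s (last q t) (+) (winding q t p (+) winding q t (last p s)) =
  upper (q - p) (+) upper (last q t - p) (+) (upper (q - last p s) (+) upper (last q t - last p s)).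
Proof.
move=> r0 ps qt fst; have rr0 : 0 < r + r by rewrite addr_gt0.
rewrite (winding_grid r0 ps qt fst).
have wqt : path (box_close (r + r)) q t by apply: sub_path qt => a b; apply: box_close_widen.
have far_sym a b : box_far (r + r) a b = box_far (r + r) b a.
  by apply/or4P/or4P => -[h|h|h|h]; [constructor 2|constructor 1|constructor 4|constructor 3|
    constructor 2|constructor 1|constructor 4|constructor 3].
have fq a : a \in p :: s -> all (box_far (r + r) ^~ a) (q :: t).
  by move=> /(allP fst) /allP h; apply/allP => b /h; rewrite far_sym.
rewrite (winding_reversed rr0 wqt (fq _ (mem_head _ _))).
rewrite (winding_reversed rr0 wqt (fq _ (mem_last _ _))).
by case: (winding q t p); case: (winding q t _); case: (upper _) => //=; case: (upper _) => //=;
case: (upper _) => //=; case: (upper _).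
Qed.

Lemma no_far_K5_drawing r (v : nat -> (R * R)%type) (s : nat -> nat -> seq (R * R)) : 0 < r ->
  (forall i j, (i < j < 5)%N -> path (box_close r) (v i) (s i j) /\ last (v i) (s i j) = v j) ->
  (forall i j, (i < j < 5)%N -> v i != v j) ->
  (forall i j k l, (i < j < 5)%N -> (k < l < 5)%N -> uniq [:: i; j; k; l] ->
     all (fun a => all (box_far (r + r) a) (v k :: s k l)) (v i :: s i j)) -> False.
Proof.
move=> r0 path_s neq_v far_s.
pose w i j k := winding (v i) (s i j) (v k); pose u i j := upper (v i - v j).
have eqw i j k l : (i < j < 5)%N -> (k < l < 5)%N -> uniq [:: i; j; k; l] ->
    w i j k (+) w i j l (+) (w k l i (+) w k l j) = u k i (+) u l i (+) (u k j (+) u l j).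
  move=> ij kl uijkl; have [ps lps] := path_s _ _ ij; have [pt lpt] := path_s _ _ kl.
  by have := winding_far_paths r0 ps pt (far_s _ _ _ _ ij kl uijkl); rewrite lps lpt.
have uN i j : (i < j < 5)%N -> u j i = ~~ u i j.
  by move=> ij; rewrite /u -upperN ?opprB // subr_eq0 neq_v.
exact: K5_parity uN eqw.
Qed.
End DiscretePaths.

(** * Planar graphs have no K5 minor *)

From Stdlib Require Rdefinitions.
From mathcomp Require Import classical_sets reals topology normedtype.
From mathcomp Require Import Rstruct Rstruct_topology interval_inference.
Import numFieldNormedType.Exports.

Local Notation R := Rdefinitions.R.

Section Curves.
Local Open Scope classical_set_scope.
Local Open Scope ring_scope.
Implicit Types (g h : R -> (R * R)%type).

Lemma ball_box_close r (p q : (R * R)%type) : ball p r q -> box_close r p q.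
Proof.
case: p q => [? ?] [? ?] [/=]; rewrite /ball /= !ltr_norml /box_close /= => /andP[? ?] /andP[? ?].
apply/and4P; split; lra.
Qed.

Lemma curve_continuous g r x : {within unit_itv, continuous g} -> 0 < r -> unit_itv x ->
  exists2 d, 0 < d & forall y, unit_itv y -> `|x - y| < d -> box_close r (g x) (g y).
Proof.
move=> /subspace_continuousP cg r0 xK.
have := cg x xK _ (nbhsx_ballx (g x) r r0).
move=> /nbhs_ballP[d /= d0 sub]; exists d => // y yK xy.
by apply: ball_box_close; apply: sub.
Qed.

Lemma unit_itv_compact : compact unit_itv.
Proof.
have -> : unit_itv = `[0, 1]%classic by apply/seteqP; split=> x /=; rewrite in_itv.
exact: segment_compact.
Qed.

Lemma natSinv_lt_eventually (d : R) : 0 < d -> exists n0 : nat, forall n : nat, (n0 <= n)%N -> n.+1%:R^-1 < d.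
Proof.
move=> d0; have [N _ h] := near_infty_natSinv_lt (PosNum d0).
by exists N => n; apply: h.
Qed.

Lemma curve_unif_continuous g r : {within unit_itv, continuous g} -> 0 < r ->
  exists n0, forall n, (n0 <= n)%N -> forall x y, unit_itv x -> unit_itv y ->
    `|x - y| <= n.+1%:R^-1 -> box_close r (g x) (g y).
Proof.
move=> cg r0.
pose P (n : nat) (x : R) := forall y, unit_itv y -> `|x - y| <= n.+1%:R^-1 -> box_close r (g x) (g y).
have [x xK | n0 _ h] := (near_covering_withinP _).2 ((compact_near_coveringP _).1 unit_itv_compact) nat \oo P _.
  have r2 : 0 < r / 2 by lra.
  have [d d0 hd] := curve_continuous cg r2 xK.
  have [n0 hn0] := natSinv_lt_eventually (ltac:(lra) : 0 < d / 2).
  exists (ball x (d / 2), [set n | (n0 <= n)%N]).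
    by split=> /=; [apply: nbhsx_ballx; lra | exists n0].
  case=> z n [] /= xz n0n zK y yK zy; have zy' := le_lt_trans zy (hn0 n n0n).
  have xz' : `|x - z| < d / 2 := xz.
  have hz : box_close (r / 2) (g x) (g z) by apply: hd => //; lra.
  have hy : box_close (r / 2) (g x) (g y).
    apply: hd => //; have := ler_normD (x - z) (z - y); rewrite addrA subrK.
    by move: xz' zy'; set u := `|x - z|; set v := `|z - y|; set w := `|x - y| => *; lra.
  move: hz hy; rewrite /box_close => /and4P[? ? ? ?] /and4P[? ? ? ?]; apply/and4P; split; lra.
by exists n0 => n n0n x y xK yK; apply: (h n n0n).
Qed.

Lemma curves_far g h : {within unit_itv, continuous g} -> {within unit_itv, continuous h} ->
  (forall s t, unit_itv s -> unit_itv t -> g s <> h t) ->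
  exists n0, forall n, (n0 <= n)%N -> forall s t, unit_itv s -> unit_itv t ->
    box_far n.+1%:R^-1 (g s) (h t).
Proof.
move=> cg ch dis.
pose P (n : nat) (x : R * R) := box_far n.+1%:R^-1 (g x.1) (h x.2).
have [[s t] [/= sK tK] | n0 _ H] := (near_covering_withinP _).2
  ((compact_near_coveringP _).1 (compact_setX unit_itv_compact unit_itv_compact)) nat \oo P _.
  have [r r0 hr] : exists2 r, 0 < r & box_far r (g s) (h t).
    have := dis s t sK tK; case: (g s) (h t) => [a b] [c d] ne.
    pose m := Num.max `|a - c| `|b - d|.
    exists m.
      rewrite lt_max !normr_gt0 !subr_eq0 -negb_and; apply/negP => /andP[/eqP ac /eqP bd].
      by apply: ne; rewrite ac bd.
    rewrite box_farE; apply/negP => /and4P[/= h1 h2 h3 h4].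
    have : m < m; last by rewrite ltxx.
    by rewrite {1}/m gt_max !ltr_norml; apply/andP; split; apply/andP; split; lra.
  have [d d0 hd] := curve_continuous cg (ltac:(lra) : 0 < r / 3) sK.
  have [d' d'0 hd'] := curve_continuous ch (ltac:(lra) : 0 < r / 3) tK.
  have [n0 hn0] := natSinv_lt_eventually (ltac:(lra) : 0 < r / 3).
  exists (ball (s, t) (Num.min d d'), [set n | (n0 <= n)%N]).
    by split=> /=; [apply: nbhsx_ballx; rewrite lt_min d0 | exists n0].
  case=> [[s' t']] n [] /= [/= ss' tt'] n0n [/= s'K t'K]; have nd := hn0 n n0n.
  have /and4P[a1 a2 a3 a4] : box_close (r / 3) (g s) (g s').
    by apply: hd => //; apply: lt_le_trans ss' _; rewrite ge_min lexx.
  have /and4P[b1 b2 b3 b4] : box_close (r / 3) (h t) (h t').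
    by apply: hd' => //; apply: lt_le_trans tt' _; rewrite ge_min lexx orbT.
  rewrite /P /= box_farE; apply: contraL hr => /and4P[c1 c2 c3 c4]; rewrite box_farE negbK.
  move: {c1 c2 c3 c4} (lt_trans c1 nd) (lt_trans c2 nd) (lt_trans c3 nd) (lt_trans c4 nd) => c1 c2 c3 c4.
  by clear -a1 a2 a3 a4 b1 b2 b3 b4 c1 c2 c3 c4; apply/and4P; split; lra.
by exists n0 => n n0n s t sK tK; apply: (H n n0n (s, t)).
Qed.

Lemma eventually_all (I : finType) (P : I -> nat -> Prop) :
  (forall i, exists n0, forall n, (n0 <= n)%N -> P i n) ->
  exists n0, forall n, (n0 <= n)%N -> forall i, P i n.
Proof.
case/fin_all_exists => f Pf; exists (\max_i f i)%N => n le_n i.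
by apply: Pf; apply: leq_trans le_n; apply: leq_bigmax.
Qed.

Section PlanarDrawing.
Variables (V : finType) (e : rel V) (p : V -> (R * R)%type) (c : V -> V -> R -> (R * R)%type).
Hypothesis p_inj : injective p.
Hypothesis curve : forall x y, e x y ->
  {within unit_itv, continuous (c x y)} /\ {in unit_itv &, injective (c x y)} /\
  c x y 0 = p x /\ c x y 1 = p y /\ (forall t z, open_unit_itv t -> c x y t <> p z).
Hypothesis noncrossing : forall x y x' y', e x y -> e x' y' ->
  ~ ((x == x') && (y == y') || (x == y') && (y == x')) ->
  forall s t, open_unit_itv s -> open_unit_itv t -> c x y s <> c x' y' t.

Lemma unit_itv_cases (t : R) : unit_itv t -> [\/ t = 0, t = 1 | open_unit_itv t].
Proof.
rewrite /unit_itv /open_unit_itv /= => /andP[t0 t1].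
have [-> | t0'] := eqVneq t 0; first by constructor 1.
have [-> | t1'] := eqVneq t 1; first by constructor 2.
by constructor 3; rewrite !lt_neqAle t0 t1 t1' eq_sym t0'.
Qed.

Lemma disjoint_edges_curves x y x' y' : e x y -> e x' y' ->
  x != x' -> x != y' -> y != x' -> y != y' ->
  forall s t, unit_itv s -> unit_itv t -> c x y s <> c x' y' t.
Proof.
move=> xy xy' n1 n2 n3 n4 s t sK tK.
have [_ [_ [c0 [c1 cp]]]] := curve xy; have [_ [_ [c0' [c1' cp']]]] := curve xy'.
have ne a b : a != b -> p a <> p b by move=> /eqP ab /p_inj.
have [-> | -> | so] := unit_itv_cases sK; have [-> | -> | to] := unit_itv_cases tK;
  rewrite ?c0 ?c1 ?c0' ?c1'; try exact: ne; try exact: cp.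
- by move=> /esym; apply: cp'.
- by move=> /esym; apply: cp'.
- by apply: noncrossing => //; rewrite (negPf n1) (negPf n2).
Qed.

Definition samples n x y : seq (R * R) :=
  [seq c x y (m%:R / n.+1%:R) | m <- iota 1 n.+1].

Fixpoint walk_samples n x q : seq (R * R) :=
  if q is y :: q' then samples n x y ++ walk_samples n y q' else [::].

Lemma unit_itv_frac n m : (m <= n.+1)%N -> unit_itv (m%:R / n.+1%:R).
Proof.
move=> mn; rewrite /unit_itv /= divr_ge0 ?ler0n //=.
by rewrite ler_pdivrMr ?ltr0Sn // mul1r ler_nat.
Qed.

Lemma mem_samples n x y z : z \in samples n x y -> exists2 t, unit_itv t & z = c x y t.
Proof.
move=> /mapP[m mn ->]; exists (m%:R / n.+1%:R) => //.
by apply: unit_itv_frac; move: mn; rewrite mem_iota; lia.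
Qed.

Lemma last_samples n x y : e x y -> last (p x) (samples n x y) = p y.
Proof.
move=> xy; have [_ [_ [c0 [c1 cp]]]] := curve xy.
by rewrite /samples -addn1 iotaD map_cat last_cat /= addnC divff ?c1 //.
Qed.

Lemma path_samples r n x y : e x y ->
  (forall s t, unit_itv s -> unit_itv t -> `|s - t| <= n.+1%:R^-1 -> box_close r (c x y s) (c x y t)) ->
  path (box_close r) (p x) (samples n x y).
Proof.
move=> xy unif; have [_ [_ [c0 _]]] := curve xy.
have -> : p x = c x y (0%:R / n.+1%:R) by rewrite mul0r.
pose f (m : nat) := c x y (m%:R / n.+1%:R).
suff h k m : (m + k <= n.+1)%N -> path (relpre f (box_close r)) m (iota m.+1 k).
  by rewrite -[c x y _]/(f 0%N) /samples -/f path_map h.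
elim: k m => //= k IH m; rewrite addnS => mk; rewrite IH ?addSn // andbT.
apply: unif; try apply: unit_itv_frac; try lia.
by rewrite -mulrBl -addn1 natrD opprD addNKr mulN1r normrN ger0_norm ?invr_ge0 ?ler0n.
Qed.

Lemma path_walk_samples r n x q :
  (forall a b s t, e a b -> unit_itv s -> unit_itv t -> `|s - t| <= n.+1%:R^-1 ->
    box_close r (c a b s) (c a b t)) ->
  path e x q -> path (box_close r) (p x) (walk_samples n x q) /\
    last (p x) (walk_samples n x q) = p (last x q).
Proof.
move=> unif; elim: q x => [//|y q IH] x /andP[xy /IH[pq lq]].
have -> : walk_samples n x (y :: q) = samples n x y ++ walk_samples n y q by [].
rewrite cat_path last_cat last_samples // pq andbT; split=> //.
by apply: path_samples => // s t; apply: unif.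
Qed.

Lemma mem_walk_samples n x q z : path e x q -> q != [::] -> z \in p x :: walk_samples n x q ->
  exists a b t, [/\ e a b, a \in x :: q, b \in x :: q, unit_itv t & z = c a b t].
Proof.
move=> eq q0; rewrite inE => /predU1P[-> | zq].
  case: q eq q0 => // y q /andP[xy _] _; have [_ [_ [c0 _]]] := curve xy.
  exists x, y, 0; rewrite !inE !eqxx orbT c0; split=> //.
  by rewrite /unit_itv /= lexx ler01.
elim: q x eq {q0} zq => // y q IH x /andP[xy yq].
have -> : walk_samples n x (y :: q) = samples n x y ++ walk_samples n y q by [].
rewrite mem_cat => /orP[/mem_samples[t tK ->] | zw].
  by exists x, y, t; rewrite !inE !eqxx orbT.
have [a [b [t [ab aq bq tK zE]]]] := IH y yq zw.
by exists a, b, t; split; rewrite // in_cons ?aq ?bq orbT.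
Qed.

End PlanarDrawing.

Theorem planar_K5_minor_free (V : finType) (e : rel V) : planar e -> ~ K5_minor e.
Proof.
move=> [p [c [p_inj [curve noncr]]]] [B [connB adjB]].
have [n1 far1] : exists n0, forall n, (n0 <= n)%N -> forall q : (V * V) * (V * V),
    e q.1.1 q.1.2 -> e q.2.1 q.2.2 ->
    [&& q.1.1 != q.2.1, q.1.1 != q.2.2, q.1.2 != q.2.1 & q.1.2 != q.2.2] ->
    forall s t, unit_itv s -> unit_itv t ->
    box_far n.+1%:R^-1 (c q.1.1 q.1.2 s) (c q.2.1 q.2.2 t).
  apply: eventually_all => -[[x y] [x' y']] /=.
  have [xy|] := boolP (e x y); last by exists 0%N.
  have [xy'|] := boolP (e x' y'); last by exists 0%N.
  have [/and4P[d1 d2 d3 d4]|] := boolP [&& _, _, _ & _]; last by exists 0%N.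
  have [n0 h] := curves_far (curve _ _ xy).1 (curve _ _ xy').1
    (disjoint_edges_curves p_inj curve noncr xy xy' d1 d2 d3 d4).
  by exists n0 => n n0n _ _ _; apply: h.
pose r : R := n1.+1%:R^-1 / 2.
have r0 : 0 < r by rewrite divr_gt0 ?invr_gt0 ?ltr0n.
have rr : r + r = n1.+1%:R^-1 by rewrite /r -splitr.
have [n unif] : exists n0, forall n, (n0 <= n)%N -> forall q : V * V, forall s t,
    e q.1 q.2 -> unit_itv s -> unit_itv t -> `|s - t| <= n.+1%:R^-1 ->
    box_close r (c q.1 q.2 s) (c q.1 q.2 t).
  apply: eventually_all => -[x y] /=.
  have [xy|] := boolP (e x y); last by exists 0%N.
  have [n0 h] := curve_unif_continuous (curve _ _ xy).1 r0.
  by exists n0 => n n0n s t _; apply: h.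
have {}unif a b s t := unif n (leqnn n) (a, b) s t.
have {}far1 a b a' b' s t := far1 n1 (leqnn n1) ((a, b), (a', b')) ^~ s ^~ t.
have [_ [x0 [_ [x0B _ _]]]] := adjB 0%N 1%N isT.
have /choice[v vB] : forall i, exists x, (i < 5)%N -> x \in B i.
  case=> [|i]; first by exists x0.
  have [i5|] := ltnP i.+1 5; last by exists x0.
  by have [_ [x [y [_ yB _]]]] := adjB 0%N i.+1 i5; exists y.
have walk_exists i j : (i < j < 5)%N -> exists q,
    [/\ path e (v i) q, last (v i) q = v j, q != [::] & {subset v i :: q <= B i :|: B j}].
  move=> ij; have [_ [a [b [aB bB ab]]]] := adjB i j ij.
  have [i5 j5] : (i < 5)%N /\ (j < 5)%N by move/andP: ij => [ij j5]; split=> //; apply: ltn_trans j5.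
  have inside k x y : (k < 5)%N -> x \in B k -> y \in B k -> exists q,
      [/\ path e x q, last x q = y & {subset x :: q <= B k}].
    move=> k5 xB yB; have /connectP[q pq ->] := connB k k5 x y xB yB.
    exists q; split=> //; first by apply: sub_path pq => ? ? /and3P[].
    move=> z; rewrite inE => /predU1P[-> // |].
    elim: q x {xB} pq => //= w q IH x /andP[/and3P[_ wB _] pq].
    by rewrite inE => /predU1P[-> // | zq]; apply: IH pq zq.
  have [q1 [p1 l1 s1]] := inside i (v i) a i5 (vB i i5) aB.
  have [q2 [p2 l2 s2]] := inside j b (v j) j5 bB (vB j j5).
  exists (q1 ++ b :: q2); split.
  - by rewrite cat_path p1 /= l1 ab.
  - by rewrite last_cat.
  - by case: q1 {p1 l1 s1}.
  - move=> z; rewrite -cat_cons mem_cat finset.in_setU => /orP[/s1 -> // | /s2 ->].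
    by rewrite orbT.
have /choice[w wP] : forall ij : nat * nat, exists q, (ij.1 < ij.2 < 5)%N ->
    [/\ path e (v ij.1) q, last (v ij.1) q = v ij.2, q != [::] &
       {subset v ij.1 :: q <= B ij.1 :|: B ij.2}].
  move=> [i j]; have [ij|] := boolP (i < j < 5)%N; last by exists [::].
  by have [q qP] := walk_exists i j ij; exists q.
have {}wP i j := wP (i, j).
have disB i j x y : (i < 5)%N -> (j < 5)%N -> i != j -> x \in B i -> y \in B j -> x != y.
  move=> i5 j5; rewrite neq_ltn => /orP[] lt_ij xB yB; apply/eqP => xy; subst y.
    have [|d _] := adjB i j _; first by rewrite lt_ij.
    by rewrite (disjointFr d xB) in yB.
  have [|d _] := adjB j i _; first by rewrite lt_ij.
  by rewrite (disjointFr d yB) in xB.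
apply: (@no_far_K5_drawing R r (p \o v) (fun i j => walk_samples c n (v i) (w (i, j))) r0).
- move=> i j ij; have [pw lw _ _] := wP i j ij.
  have [ps ls] := path_walk_samples curve unif pw.
  by split=> //; rewrite [LHS]ls lw.
- move=> i j /andP[ij j5]; have i5 := ltn_trans ij j5.
  by rewrite /= (inj_eq p_inj) (disB i j) ?vB // neq_ltn ij.
move=> i j k l ij kl uijkl.
have [[ik il] [jk jl]] : (i != k /\ i != l) /\ (j != k /\ j != l).
  by move: uijkl; rewrite /= !inE !negb_or !andbT => /and3P[/and3P[_ ik il] /andP[jk jl] _].
have [pw lw nw sw] := wP i j ij; have [pw' lw' nw' sw'] := wP k l kl.
have [i5 j5] : (i < 5)%N /\ (j < 5)%N by move/andP: ij => [ij j5]; split=> //; apply: ltn_trans j5.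
have [k5 l5] : (k < 5)%N /\ (l < 5)%N by move/andP: kl => [kl l5]; split=> //; apply: ltn_trans l5.
apply/allP => z zw; apply/allP => z' zw'.
have [a [b [s [ab /sw aB /sw bB sK ->]]]] := mem_walk_samples curve pw nw zw.
have [a' [b' [t [ab' /sw' aB' /sw' bB' tK ->]]]] := mem_walk_samples curve pw' nw' zw'.
have dis x y : x \in B i :|: B j -> y \in B k :|: B l -> x != y.
  rewrite !finset.in_setU => /orP[] xB /orP[] yB;
  by [apply: (disB i k) | apply: (disB i l) | apply: (disB j k) | apply: (disB j l)].
by rewrite rr; apply: far1 => //; rewrite !dis.
Qed.
End Curves.

Theorem theorem1p6 (V : finType) (e : rel V) (M : rel V) :
  simple_graph e -> planar e -> (27 <= max_degree e)%N ->
  distance3_matching e M ->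
  forall (cvH : V -> nat) (ceH : V -> V -> nat),
    total_coloring (matching_vertices M) M (max_degree e).+1 cvH ceH ->
    exists (cv : V -> nat) (ce : V -> V -> nat),
      total_coloring predT e (max_degree e).+1 cv ce /\
      (forall x, matching_vertices M x -> cv x = cvH x) /\
      (forall x y, M x y -> ce x y = ceH x y).
Proof.
move=> [se ie] /planar_K5_minor_free noK5 D27 dist cvH ceH colH.
have [|v|cv [ce [col cvP ceM]]] := extend_sparse _ colH se ie noK5 _ dist.
- by [].
- by rewrite ltnS; apply: (leq_bigmax v).
by exists cv, ce.
Qed.
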